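(* Let $n$ and $l$ be integers with $2\le l\le n$, let $\lambda\vdash n$ and $\mu\vdash n-1$ be partitions such that $\mu$ is obtained from $\lambda$ by removing one box, and let $\phi_{\lambda,\mu}$ be the generalized character of $S_n$ associated with $(\lambda,\mu)$. If $\theta\in S_l$ then \[ \phi_{\lambda,\mu}(\theta)=\frac{1}{(n-1)_{l-1}}\sum_{\substack{\gamma,\sigma\in S_l:\\ \gamma\sigma=\theta}}\mathrm{sign}(\gamma)\,N^{\lambda,\mu}(\gamma,\sigma). \]
   Context: $S_n$ is the group of permutations of $\{1,2,\dotsc,n\}$. For $1\le l\le n$, $S_l\le S_n$ denotes the subgroup of permutations of $\{1,2,\dotsc,l\}$ (fixing $l+1,\dotsc,n$). $\widetilde{S}_{n-1}\le S_n$ denotes the stabilizer of the point $1$; it is isomorphic to the symmetric group of degree $n-1$ (acting on $\{2,\dotsc,n\}$). For $\lambda\vdash n$, $\chi^\lambda$ is the (non-normalized) character of the irreducible representation $S^\lambda$ of $S_n$ indexed by $\lambda$; for $\mu\vdash n-1$, $\chi^\mu$ is the (non-normalized) character of the irreducible representation $S^\mu$ of $\widetilde{S}_{n-1}$ indexed by $\mu$ (standard labelling, with the one-row partition giving the trivial representation). If $\mu$ is obtained from $\lambda$ by removing one box, the generalized character $\phi_{\lambda,\mu}:S_n\to\mathbb{C}$ is \[ \phi_{\lambda,\mu}(g)=\frac{1}{(n-1)!}\sum_{h\in\widetilde{S}_{n-1}}\overline{\chi^\lambda(gh)}\;\overline{\chi^\mu(h)} . \] (It is the spherical function of the Gelfand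 pair $(S_n\times \widetilde{S}_{n-1},\mathrm{diag}\,\widetilde{S}_{n-1})$ attached to $S^\lambda\boxtimes S^\mu$.) A partition is identified with its Young frame. The removed box is denoted $\lambda\setminus\mu$. For a box $\square$ of $\lambda$, $r(\square)$ and $c(\square)$ denote respectively the (index of the) row and the column to which $\square$ belongs. Falling factorial: $(x)_k=x(x-1)\dotsb(x-k+1)$. For $\gamma\in S_l$, $C(\gamma)$ is the set of cycles of $\gamma$ as a permutation of $\{1,\dotsc,l\}$, fixed points being counted as cycles of length one; a cycle is also regarded as the subset of $\{1,\dotsc,l\}$ it moves cyclically. For $\gamma,\sigma\in S_l$, a coloring of the cycles of $\gamma,\sigma$ is a function $h:C(\gamma)\sqcup C(\sigma)\to\mathbb{N}$ (disjoint union). $N^{\lambda,\mu}(\gamma,\sigma)$ is the number of colorings $h$ of the cycles of $\gamma$ and $\sigma$ such that: - the color of each cycle of $\gamma$ is (the index of) a column of $\lambda$; - the color of each cycle of $\sigma$ is (the index of) a row of $\lambda$; - the color of the cycle of $\gamma$ containing $1$ is $c(\lambda\setminus\mu)$; - the color of the cycle of $\sigma$ containing $1$ is $r(\lambda\setminus\mu)$; - if $c_1\in C(\gamma)$, $c_2\in C(\sigma)$ and $c_1\cap c_2\neq\emptyset$, then $(h(c_1),h(c_2))$ are the coordinates of a box of $\lambda$, i.e. $\lambda$ has a box in column $h(c_1)$ and row $h(c_2)$. *)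

(* Defs.v *)
From mathcomp Require Import all_boot all_order all_algebra.
From mathcomp Require Import all_fingroup all_solvable all_field all_character.

Set Implicit Arguments.
Unset Strict Implicit.
Unset Printing Implicit Defensive.

Import GRing.Theory Num.Theory.
Local Open Scope ring_scope.

(* All indices are 0-based: the points 1, ..., n are the elements 0, ..., n-1 *)
(* of 'I_n, and the first row (column) of a Young frame has index 0.          *)

Definition is_part (n : nat) (lam : seq nat) : bool :=
  [&& sorted geq lam, 0%N \notin lam & sumn lam == n].

(* A box is a pair (row, column). *)
Definition in_frame (lam : seq nat) (b : nat * nat) : bool :=
  (b.2 < nth 0 lam b.1)%N.

Definition removes_box (lam mu : seq nat) (b : nat * nat) : Prop :=
  in_frame lam b /\ forall b', in_frame mu b' = in_frame lam b' && (b' != b).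

Section Specht.

(* The symmetric group of a finite set A of points is perm.Sym A, the group   *)
(* of permutations of T fixing every point outside A.                         *)
Variables (T : finType) (A : {set T}) (lam : seq nat).

(* The standard filling of lam by the points of A, row after row: row and     *)
(* column of the box containing x \in A.                                      *)
Definition tab_row (x : T) : nat := reshape_index lam (index x (enum A)).
Definition tab_col (x : T) : nat := reshape_offset lam (index x (enum A)).

Definition row_stab : {set {perm T}} :=
  [set s in perm.Sym A | [forall x in A, tab_row (s x) == tab_row x]].

Definition col_stab : {set {perm T}} :=
  [set s in perm.Sym A | [forall x in A, tab_col (s x) == tab_col x]].

(* The Young symmetrizer \sum_(p, q) sign(q) p q as an element of the group   *)
(* algebra, the latter being the space of the regular representation.         *)
Definition young_symmetrizer : 'rV[algC]_#|perm.Sym A| :=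
  \sum_(p in row_stab) \sum_(q in col_stab)
    (-1) ^+ q *: delta_mx 0 (gring_index (perm.Sym_group A) (p * q)%g).

(* Mathcomp representations act on row vectors from the right, so the Specht  *)
(* module is the right ideal generated by the Young symmetrizer.              *)
Definition specht_repr :=
  submod_repr (cyclic_mx_module (regular_repr algC (perm.Sym_group A))
                                young_symmetrizer).

Definition specht_char : 'CF(perm.Sym_group A) := cfRepr specht_repr.

End Specht.

(* The subset {1, ..., l} of {1, ..., n}; perm.Sym (first_points n l) is S_l. *)
Definition first_points (n l : nat) : {set 'I_n} := [set i : 'I_n | (i < l)%N].

(* The subset {2, ..., n} of {1, ..., n}; perm.Sym (nonfirst_points n) is the *)
(* stabilizer of the point 1.                                                 *)
Definition nonfirst_points (n : nat) : {set 'I_n} := [set i : 'I_n | (0 < i)%N].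

Definition gen_char (n : nat) (lam mu : seq nat) (g : 'S_n) : algC :=
  ((n.-1)`!)%:R^-1 *
  \sum_(h in perm.Sym (nonfirst_points n))
     (specht_char [set: 'I_n] lam (g * h)%g)^* *
     (specht_char (nonfirst_points n) mu h)^*.

Section Colorings.

Variables (n l : nat).

Definition cycles_of (g : 'S_n) : {set {set 'I_n}} :=
  [set porbit g x | x in first_points n l].

Definition cycleT (g : 'S_n) : finType := {c : {set 'I_n} | c \in cycles_of g}.

Definition contains_first (c : {set 'I_n}) : bool :=
  [exists x in c, nat_of_ord x == 0%N].

(* A coloring of the disjoint union is a pair h of functions; the codomains   *)
(* express that h.1 takes its values in the columns of lam (there are head 0  *)
(* lam of them) and h.2 in the rows of lam.                                   *)
Definition num_colorings (lam : seq nat) (b : nat * nat) (g s : 'S_n) : nat :=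
  #|[set h : {ffun cycleT g -> 'I_(head 0%N lam)} *
             {ffun cycleT s -> 'I_(size lam)} |
     [&& [forall c, contains_first (val c) ==> (nat_of_ord (h.1 c) == b.2)],
         [forall c, contains_first (val c) ==> (nat_of_ord (h.2 c) == b.1)]
       & [forall c1, forall c2, (val c1 :&: val c2 != set0) ==>
            in_frame lam (nat_of_ord (h.2 c2), nat_of_ord (h.1 c1))]]]|.

End Colorings.

(* Main.v *)
Require Import Defs.
From HB Require Import structures.
From mathcomp Require Import all_boot all_order all_algebra.
From mathcomp Require Import all_fingroup all_solvable all_field all_character.
Import GRing.Theory Num.Theory.
Local Open Scope ring_scope.
Set Implicit Arguments.
Unset Strict Implicit.
Unset Printing Implicit Defensive.

(** Work in the group algebra of S_n, with product the convolution of functions.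
    Let K be the stabilizer of the first point, c the Young symmetrizer of a
    tableau of shape lam with the first point in the box b, and d the Young
    symmetrizer of the tableau of shape mu obtained by erasing that point. The
    characters of lam and mu are, up to explicit scalars, the sums of the
    conjugates of c under S_n and of d under K ([specht_charE]), so the
    generalized character is a multiple of the product of these two sums. The
    heart of the proof is that it equals the sum of the conjugates of c under K
    alone, divided by (n-1)! ([isotypic_product], [gen_char_conj_sum]).

    The reason is as follows. Every permutation is conjugate to its inverse by
    an element of K ([perm_inv_conj]), so the centralizer of K in the group
    algebra is commutative (Gelfand's trick), hence the module of mu occurs at
    most once in the module of lam. Concretely, d X c Y d is always a multiple of
    d c d ([corner_line]). Moreover c = d on K, because p q with p preserving
    rows and q preserving columns fixes a point only if both p and q do; this
    makes d c d nonzero and yields all normalizations. Finally, if d = a b is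
    the product of its row and column parts, then c is a multiple of a c b, so the
    sum of the K-conjugates of c lies in the isotypic component of mu
    ([conj_sum_mul_conj_sum]).

    It remains to expand. The conjugates of c under K are the Young symmetrizers
    of the tableaux of shape lam with the first point in b. The coefficient of
    such a symmetrizer at an element of S_l only involves row and column
    permutations in S_l, and only depends on the boxes of the points 1, ..., l;
    so the sum runs over the injective maps from these points to the boxes, each
    one arising from (n-l)! tableaux. Maps that are not injective may be added
    for free: multiplying gamma and sigma by the transposition of two points in
    the same box changes only the sign ([young_repeated]). A map from the first
    l points to the boxes whose columns are constant on the cycles of gamma and
    whose rows are constant on those of sigma is exactly a coloring
    ([num_coloringsE]). *)

(** * The group algebra of a finite group *)

(** Functions on the group under convolution. The coefficients are taken in the
    regular module R^o so that scaling is the pointwise one; the name keeps the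
    convolution product apart from the pointwise product of finite functions. *)
Definition galg (R : comNzRingType) (gT : finGroupType) : Type :=
  {ffun gT -> R^o}.

HB.instance Definition _ (R : comNzRingType) (gT : finGroupType) :=
  GRing.Lmodule.copy (galg R gT) {ffun gT -> R^o}.

Section GroupAlgebra.

Variables (R : comNzRingType) (gT : finGroupType).
Local Notation AA := (galg R gT).
Implicit Types (x y z : AA) (g h : gT).

Definition gmul x y : AA := [ffun g => \sum_h x h * y (h^-1 * g)%g].

Definition gelt g : AA := [ffun h => (h == g)%:R].

Fact gmulA : associative gmul.
Proof.
move=> x y z; apply/ffunP=> g; rewrite !ffunE.
under eq_bigr do rewrite ffunE big_distrr /=.
rewrite exchange_big /=; under [RHS]eq_bigr do rewrite ffunE big_distrl /=.
rewrite [RHS]exchange_big [LHS]exchange_big; apply: eq_bigr => h _.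
rewrite (reindex_inj (mulgI h^-1%g)) /=; apply: eq_bigr => k _.
by rewrite mulrA; congr (_ * z _); rewrite invMg invgK -!mulgA mulKVg.
Qed.

Fact gmul1l : left_id (gelt 1%g) gmul.
Proof.
move=> x; apply/ffunP=> g; rewrite !ffunE (bigD1 1%g) //= big1 ?addr0.
  by rewrite ffunE eqxx mul1r invg1 mul1g.
by move=> h /negPf ne; rewrite ffunE ne mul0r.
Qed.

Fact gmul1r : right_id (gelt 1%g) gmul.
Proof.
move=> x; apply/ffunP=> g; rewrite !ffunE (bigD1 g) //= big1 ?addr0.
  by rewrite ffunE mulVg eqxx mulr1.
move=> h ne; rewrite ffunE -(inj_eq (mulgI h)) mulKVg mulg1 eq_sym (negPf ne).
by rewrite mulr0.
Qed.

Fact gmulDl : left_distributive gmul +%R.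
Proof.
move=> x y z; apply/ffunP=> g; rewrite !ffunE -big_split.
by apply: eq_bigr => h _; rewrite ffunE mulrDl.
Qed.

Fact gmulDr : right_distributive gmul +%R.
Proof.
move=> x y z; apply/ffunP=> g; rewrite !ffunE -big_split.
by apply: eq_bigr => h _; rewrite ffunE mulrDr.
Qed.

Fact gelt1_neq0 : gelt 1%g != 0.
Proof.
by apply/eqP=> /ffunP/(_ 1%g)/eqP; rewrite !ffunE eqxx oner_eq0.
Qed.

HB.instance Definition _ := GRing.Zmodule_isNzRing.Build AA
  gmulA gmul1l gmul1r gmulDl gmulDr gelt1_neq0.

Fact gscalerAl (a : R) x y : a *: (x * y) = (a *: x) * y.
Proof.
apply/ffunP=> g; rewrite !ffunE /GRing.scale /= big_distrr /=.
by apply: eq_bigr => h _; rewrite ffunE mulrA.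
Qed.

HB.instance Definition _ := GRing.Lmodule_isLalgebra.Build R AA gscalerAl.

Fact gscalerAr (a : R) x y : a *: (x * y) = x * (a *: y).
Proof.
apply/ffunP=> g; rewrite !ffunE /GRing.scale /= big_distrr /=.
by apply: eq_bigr => h _; rewrite ffunE mulrCA.
Qed.

HB.instance Definition _ := GRing.Lalgebra_isAlgebra.Build R AA gscalerAr.

Lemma galgE x y g : (x * y) g = \sum_h x h * y (h^-1 * g)%g.
Proof. by rewrite ffunE. Qed.

Lemma galg_scaleE (a : R) x g : (a *: x) g = a * x g.
Proof. by rewrite ffunE. Qed.

Lemma galg_sumE (I : Type) (r : seq I) (P : pred I) (F : I -> AA) g :
  (\sum_(i <- r | P i) F i) g = \sum_(i <- r | P i) F i g.
Proof. by rewrite sum_ffunE. Qed.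

Lemma galg_subE x y g : (x - y) g = x g - y g.
Proof. by rewrite !ffunE. Qed.

Lemma gelt1 : gelt 1%g = 1. Proof. by []. Qed.

Lemma galg_geltl g x h : (gelt g * x) h = x (g^-1 * h)%g.
Proof.
rewrite galgE (bigD1 g) //= big1 ?addr0 ?ffunE ?eqxx ?mul1r //.
by move=> k /negPf ne; rewrite ffunE ne mul0r.
Qed.

Lemma galg_geltr g x h : (x * gelt g) h = x (h * g^-1)%g.
Proof.
rewrite galgE (bigD1 (h * g^-1)%g) //= big1 ?addr0.
  by rewrite ffunE invMg invgK mulgKV eqxx mulr1.
move=> k ne; rewrite ffunE -(inj_eq (mulgI k)) mulKVg -(inj_eq (mulIg g^-1%g)).
by rewrite mulgK eq_sym (negPf ne) mulr0.
Qed.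

Lemma geltM g h : gelt (g * h)%g = gelt g * gelt h.
Proof.
by apply/ffunP=> k; rewrite galg_geltl !ffunE -(inj_eq (mulgI g^-1%g)) mulKg.
Qed.

Lemma geltVr g : gelt g * gelt g^-1%g = 1.
Proof. by rewrite -geltM mulgV. Qed.

Lemma geltVl g : gelt g^-1%g * gelt g = 1.
Proof. by rewrite -geltM mulVg. Qed.

Lemma galg_expand x : x = \sum_g x g *: gelt g.
Proof.
apply/ffunP=> h; rewrite galg_sumE (bigD1 h) //= big1 ?addr0.
  by rewrite galg_scaleE ffunE eqxx mulr1.
by move=> g; rewrite eq_sym galg_scaleE ffunE => /negPf->; rewrite mulr0.
Qed.

(** The coefficient of the neutral element is a trace, and all the scalars below
    are read off through it. *)
Lemma galg_traceC x y : (x * y) 1%g = (y * x) 1%g.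
Proof.
rewrite !galgE (reindex_inj invg_inj); apply: eq_bigr => g _ /=.
by rewrite !mulg1 invgK mulrC.
Qed.

Lemma galg_trace_gelt x g : (x * gelt g) 1%g = x g^-1%g.
Proof. by rewrite galg_geltr mul1g. Qed.

(** The linear anti-automorphism extending inversion. *)
Definition star x : AA := [ffun g => x g^-1%g].

Lemma starE x g : star x g = x g^-1%g. Proof. exact: ffunE. Qed.

Lemma starM x y : star (x * y) = star y * star x.
Proof.
apply/ffunP=> g; rewrite ffunE !galgE (reindex_inj (mulgI g^-1%g)) /=.
apply: eq_bigr => h _.
by rewrite !starE !invMg !invgK mulgK mulrC.
Qed.

Definition supported_in (A : {set gT}) x := forall g, g \notin A -> x g = 0.

Lemma supported_expand (A : {set gT}) x :
  supported_in A x -> x = \sum_(g in A) x g *: gelt g.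
Proof.
move=> sx; rewrite {1}[x]galg_expand (bigID (mem A)) /= [X in _ + X]big1 ?addr0 //.
by move=> g /sx->; rewrite scale0r.
Qed.

Lemma supported_sum (A : {set gT}) (I : Type) (r : seq I) (P : pred I) (F : I -> AA) :
  (forall i, P i -> supported_in A (F i)) ->
  supported_in A (\sum_(i <- r | P i) F i).
Proof. by move=> sF g Ag; rewrite galg_sumE big1 // => i Pi; apply: sF. Qed.

Lemma supported_gelt (A : {set gT}) g : g \in A -> supported_in A (gelt g).
Proof. by move=> Ag h; rewrite ffunE; case: eqP => // ->; rewrite Ag. Qed.

Lemma supportedM (K : {group gT}) x y :
  supported_in K x -> supported_in K y -> supported_in K (x * y).
Proof.
move=> sx sy g Kg; rewrite galgE big1 // => h _.
have [Kh|/sx->] := boolP (h \in K); last by rewrite mul0r.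
by rewrite sy ?mulr0 // groupMl ?groupV.
Qed.

End GroupAlgebra.

(** * Invariants under conjugation by a subgroup *)

Section Invariants.

Variables (F : numFieldType) (gT : finGroupType) (K : {group gT}).
Local Notation AA := (galg F gT).
Implicit Types (x y z w : AA) (g h k : gT).

Definition centralizes x := forall k, k \in K -> gelt F k * x = x * gelt F k.

Definition conj_sum x : AA := \sum_(k in K) gelt F k^-1%g * x * gelt F k.

Lemma conj_sum_centralizes x : centralizes (conj_sum x).
Proof.
move=> k Kk; rewrite /conj_sum mulr_sumr mulr_suml [LHS](reindex_inj (mulIg k)) /=.
apply: eq_big => [h|h _]; first by rewrite groupMr.
by rewrite invMg !geltM !mulrA geltVr mul1r.
Qed.

Lemma centralizesM x y : centralizes x -> centralizes y -> centralizes (x * y).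
Proof. by move=> ix iy k Kk; rewrite mulrA ix // -mulrA iy // mulrA. Qed.

Lemma centralizesB x y : centralizes x -> centralizes y -> centralizes (x - y).
Proof. by move=> ix iy k Kk; rewrite mulrBr mulrBl ix // iy. Qed.

Lemma centralizesZ a x : centralizes x -> centralizes (a *: x).
Proof. by move=> ix k Kk; rewrite -scalerAr ix // scalerAl. Qed.

Lemma conj_sum_mulr x y : centralizes y -> conj_sum (x * y) = conj_sum x * y.
Proof.
move=> iy; rewrite mulr_suml; apply: eq_bigr => k Kk.
by rewrite -!mulrA iy.
Qed.

Lemma conj_sum_mull x y : centralizes x -> conj_sum (x * y) = x * conj_sum y.
Proof.
move=> ix; rewrite mulr_sumr; apply: eq_bigr => k Kk.
by rewrite !mulrA ix ?groupV.
Qed.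

Lemma conj_sumZ a x : conj_sum (a *: x) = a *: conj_sum x.
Proof.
rewrite scaler_sumr; apply: eq_bigr => k _.
by rewrite -scalerAr -scalerAl.
Qed.

Lemma conj_sum_sum (I : Type) (r : seq I) (P : pred I) (G : I -> AA) :
  conj_sum (\sum_(i <- r | P i) G i) = \sum_(i <- r | P i) conj_sum (G i).
Proof.
rewrite exchange_big; apply: eq_bigr => k _.
by rewrite mulr_sumr mulr_suml.
Qed.

Lemma conj_sumJ x k : k \in K -> conj_sum (gelt F k^-1%g * x * gelt F k) = conj_sum x.
Proof.
move=> Kk; rewrite [RHS](reindex_inj (mulgI k)) /=.
apply: eq_big => [h|h _]; first by rewrite groupMl.
by rewrite invMg !geltM !mulrA.
Qed.

Lemma supported_comm w y : supported_in K w -> centralizes y -> w * y = y * w.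
Proof.
move/supported_expand=> -> iy; rewrite mulr_suml mulr_sumr.
by apply: eq_bigr => k Kk; rewrite -scalerAl -scalerAr iy.
Qed.

Lemma conj_sumC w x : supported_in K w -> conj_sum (x * w) = conj_sum (w * x).
Proof.
move/supported_expand->; rewrite mulr_suml mulr_sumr !conj_sum_sum.
apply: eq_bigr => k Kk; rewrite -scalerAl -scalerAr !conj_sumZ.
by rewrite -(conj_sumJ (gelt F k * x) Kk) !mulrA geltVl mul1r.
Qed.

Lemma trace_conj_sum x y : centralizes y -> (conj_sum x * y) 1%g = #|K|%:R * (x * y) 1%g.
Proof.
move=> iy; rewrite mulr_suml galg_sumE mulr_natl -sumr_const.
apply: eq_bigr => k Kk.
by rewrite -!mulrA iy // galg_traceC -!mulrA geltVr mulr1.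
Qed.

(** The trace form is nondegenerate on the centralizer of K: pairing with the
    sum of the K-conjugates of g^-1 picks out the coefficient at g, up to the
    factor #|K|. *)
Lemma centralizes_eq0 z :
  centralizes z -> (forall y, centralizes y -> (z * y) 1%g = 0) -> z = 0.
Proof.
move=> iz z0; apply/ffunP=> g.
have := z0 _ (@conj_sum_centralizes (gelt F g^-1%g)).
rewrite galg_traceC trace_conj_sum // galg_traceC galg_trace_gelt invgK => /eqP.
rewrite mulf_eq0 pnatr_eq0 (negPf (lt0n_neq0 (cardG_gt0 K))) => /eqP->.
by rewrite ffunE.
Qed.

Section Gelfand.

Hypothesis inv_conj : forall g, exists2 k, k \in K & (g ^ k = g^-1)%g.

Lemma star_centralizes y : centralizes y -> star y = y.
Proof.
move=> iy; apply/ffunP=> g; rewrite starE.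
have [k Kk <-] := inv_conj g.
have /ffunP/(_ (g * k)%g) := iy k Kk.
by rewrite galg_geltl galg_geltr mulgK conjgE mulgA.
Qed.

(** Gelfand's criterion: star reverses products but fixes every element of the
    centralizer of K, which is therefore commutative. *)
Lemma centralizes_comm x y : centralizes x -> centralizes y -> x * y = y * x.
Proof.
by move=> ix iy; rewrite -(star_centralizes (centralizesM ix iy)) starM !star_centralizes.
Qed.

End Gelfand.

End Invariants.

Section QuasiPrimitive.

Variables (F : numFieldType) (gT : finGroupType).
Local Notation AA := (galg F gT).

(** Then c / t is a primitive idempotent of the algebra of K; Young symmetrizers
    come normalized by their coefficient at the neutral element instead. *)
Definition quasi_primitive (K : {set gT}) (c : AA) (t : F) : Prop :=
  [/\ supported_in K c, c 1%g = 1, t != 0, c * c = t *: c &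
     forall x, supported_in K x -> exists s, c * x * c = s *: c].

(** Comparing traces identifies the scalar. *)
Lemma quasi_primitive_sandwich (K : {set gT}) c t x :
  quasi_primitive K c t -> supported_in K x ->
  c * x * c = (t * (c * x) 1%g) *: c.
Proof.
case=> _ c1 _ cc cxc /cxc[s cxcE]; rewrite cxcE; congr (_ *: _).
have /(congr1 (fun y : AA => y 1%g)) := cxcE.
rewrite galg_traceC mulrA cc -scalerAl !galg_scaleE c1 mulr1.
by move->.
Qed.

End QuasiPrimitive.

Section SphericalFunction.

Variables (F : numFieldType) (gT : finGroupType) (K : {group gT}).
Local Notation AA := (galg F gT).
Implicit Types (x y z w X Y : AA) (g h k : gT).

Hypothesis inv_conj : forall g, exists2 k, k \in K & (g ^ k = g^-1)%g.

Variables (c d : AA) (t u : F).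
Hypothesis qp_c : quasi_primitive [set: gT] c t.
Hypothesis qp_d : quasi_primitive K d u.
Hypothesis eq_cd : forall k, k \in K -> c k = d k.

Let t_neq0 : t != 0. Proof. by case: qp_c. Qed.
Let u_neq0 : u != 0. Proof. by case: qp_d. Qed.
Let dd : d * d = u *: d. Proof. by case: qp_d. Qed.
Let sd : supported_in K d. Proof. by case: qp_d. Qed.

Let cxc x : c * x * c = (t * (c * x) 1%g) *: c.
Proof. by apply: quasi_primitive_sandwich qp_c _ => g; rewrite inE. Qed.

Let dkd k : k \in K -> d * gelt F k * d = (u * d k^-1%g) *: d.
Proof.
move=> Kk; rewrite (quasi_primitive_sandwich qp_d) ?galg_trace_gelt //.
exact: supported_gelt.
Qed.

Lemma trace_mul_supported x w : supported_in K w ->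
  (x * w) 1%g = \sum_(k in K) x k^-1%g * w k.
Proof.
move=> sw; rewrite {1}(supported_expand sw) mulr_sumr galg_sumE.
apply: eq_bigr => k _.
by rewrite -scalerAr galg_scaleE galg_trace_gelt mulrC.
Qed.

Let trace_dd : \sum_(k in K) d k^-1%g * d k = u.
Proof.
rewrite -(trace_mul_supported d sd) dd galg_scaleE.
by case: qp_d => _ -> _ _ _; rewrite mulr1.
Qed.

Let trace_mul_cd w : supported_in K w -> (c * w) 1%g = (d * w) 1%g.
Proof.
move=> sw; rewrite !trace_mul_supported //; apply: eq_bigr => k Kk.
by rewrite eq_cd ?groupV.
Qed.

Let trace_cd : (c * d) 1%g = u.
Proof. by rewrite trace_mul_cd // trace_mul_supported. Qed.

(** The corner d AA d is d times the centralizer of K. Indeed d k d is the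
    multiple u d(k^-1) of d, so summing d k^-1 (d X d) k d over K only rescales
    d X d, by u^2 times the sum of the d(k^-1) d(k); that sum is the coefficient
    of d d at 1, namely u. *)
Lemma corner_centralizes X : u ^+ 2 *: (d * X * d) = d * conj_sum K (d * X * d).
Proof.
apply: (scalerI u_neq0).
have -> : u *: (d * conj_sum K (d * X * d)) = d * conj_sum K (d * X * d) * d.
  rewrite -[RHS]mulrA -(supported_comm sd (@conj_sum_centralizes _ _ _ _)) mulrA dd.
  by rewrite scalerAl.
rewrite scalerA -{1}trace_dd mulr_suml scaler_suml mulr_sumr mulr_suml.
apply: eq_bigr => k Kk; rewrite !mulrA dkd ?groupV // invgK -!scalerAl.
have -> : d * X * d * gelt F k * d = d * X * (d * gelt F k * d) by rewrite !mulrA.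
rewrite dkd // -scalerAr scalerA; congr (_ *: _).
by rewrite -mulrA mulrACA mulrC ![_ * u]mulrC.
Qed.

Lemma corner_comm X Y :
  (d * X * d) * (d * Y * d) = (d * Y * d) * (d * X * d).
Proof.
have u4 : u ^+ 2 * u ^+ 2 != 0 by rewrite mulf_neq0 ?expf_neq0.
have cornerM Z W : (u ^+ 2 * u ^+ 2) *: (d * Z * d * (d * W * d)) =
    d * d * (conj_sum K (d * Z * d) * conj_sum K (d * W * d)).
  rewrite -scalerA scalerAr scalerAl !corner_centralizes.
  have := supported_comm sd (@conj_sum_centralizes _ _ K (d * Z * d)).
  move: (conj_sum K _) (conj_sum K _) => Q P dP.
  by rewrite -[RHS]mulrA [d * (P * Q)]mulrA [in RHS]dP !mulrA.
apply: (scalerI u4); rewrite !cornerM; congr (_ * _).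
by apply: (centralizes_comm inv_conj); apply: conj_sum_centralizes.
Qed.

(** Since c is quasi-primitive, commuting d X c d with d c Y d collapses both
    products; so the elements d X c Y d all lie on the line of d c d. This says
    that the module of d occurs at most once in the restriction of that of c. *)
Lemma corner_line X Y :
  u *: (d * X * c * Y * d) = (c * Y * d * X) 1%g *: (d * c * d).
Proof.
have ut : u * t != 0 by rewrite mulf_neq0.
apply: (scalerI ut).
have := corner_comm (X * c) (c * Y).
have -> : d * (X * c) * d * (d * (c * Y) * d) =
          d * X * (c * (d * d) * c) * Y * d by rewrite !mulrA.
have -> : d * (c * Y) * d * (d * (X * c) * d) =
          d * (c * (Y * (d * d) * X) * c) * d by rewrite !mulrA.
rewrite dd -scalerAr -!scalerAl -!scalerAr -!scalerAl !cxc trace_cd.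
rewrite -!scalerAr -!scalerAl !scalerA !mulrA => ->.
by rewrite galg_scaleE mulrA [t * u]mulrC.
Qed.

(** Up to scaling E is the central idempotent of the module of c, and
    [conj_sum K d] that of the module of d. *)
Let E := conj_sum [set: gT] c.

Lemma isotypic_central x : x * E = E * x.
Proof. by apply: supported_comm (@conj_sum_centralizes _ _ _ c) => g; rewrite inE. Qed.

Lemma isotypic_mul_c : E * c = t ^+ 2 *: c.
Proof.
have cc : c * c = t *: c by case: qp_c.
rewrite {1}/E /conj_sum mulr_suml.
rewrite (eq_bigr (fun x : gT => t *: ((c x^-1%g *: gelt F x^-1%g) * c))).
  rewrite (reindex_inj invg_inj) /= (eq_bigl xpredT) => [|x]; last by rewrite inE.
  rewrite -scaler_sumr -mulr_suml.
  under eq_bigr do rewrite invgK.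
  by rewrite -galg_expand cc scalerA.
move=> x _.
have -> : gelt F x^-1%g * c * gelt F x * c =
    gelt F x^-1%g * (c * gelt F x * c).
  by rewrite !mulrA.
by rewrite cxc galg_trace_gelt -scalerAr -scalerAl scalerA.
Qed.

Lemma mul_d_conj_sum : d * conj_sum K d = u ^+ 2 *: d.
Proof.
rewrite /conj_sum mulr_sumr (eq_bigr (fun k => u *: (d * (d k *: gelt F k)))).
  by rewrite -scaler_sumr -mulr_sumr -(supported_expand sd) dd scalerA.
by move=> k Kk; rewrite !mulrA dkd ?groupV // invgK -scalerAl -scalerAr scalerA.
Qed.

Lemma dcd_neq0 : d * c * d != 0.
Proof.
apply/eqP=> /(congr1 (fun y : AA => y 1%g)).
rewrite -mulrA galg_traceC -mulrA dd -scalerAr galg_scaleE trace_cd ffunE.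
by apply/eqP; rewrite mulf_neq0.
Qed.

(** The case X = x^-1, Y = x of [corner_line], summed over the group. *)
Lemma isotypic_mul_d : u ^+ 2 *: (E * d) = (E * d) 1%g *: (d * c * d).
Proof.
have uEd : u *: (E * d) = \sum_(x in [set: gT]) d * gelt F x^-1%g * c * gelt F x * d.
  rewrite scalerAr -dd mulrA -isotypic_central mulr_sumr mulr_suml.
  by apply: eq_bigr => x _; rewrite !mulrA.
rewrite expr2 -scalerA uEd scaler_sumr.
under eq_bigr => x _ do rewrite corner_line.
rewrite -scaler_suml; congr (_ *: _); rewrite /E /conj_sum mulr_suml galg_sumE.
by apply: eq_bigr => x _; rewrite galg_traceC !mulrA.
Qed.

(** E d and d c d are proportional multiples of idempotents, which leaves no
    freedom for the factor. *)
Lemma trace_isotypic_mul_d : (E * d) 1%g = t * u.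
Proof.
have Ecd : E * d * c * d = t ^+ 2 *: (d * c * d).
  rewrite -isotypic_central -!mulrA [E * (c * d)]mulrA isotypic_mul_c.
  by rewrite -scalerAl -scalerAr.
have := congr1 (fun y => y * c * d) isotypic_mul_d.
rewrite -!scalerAl Ecd.
have -> : d * c * d * c * d = d * (c * d * c) * d by rewrite !mulrA.
rewrite cxc -scalerAr -scalerAl !scalerA trace_cd => /eqP.
rewrite -subr_eq0 -scalerBl scaler_eq0 (negPf dcd_neq0) orbF subr_eq0 => /eqP.
have tu : t * u != 0 by rewrite mulf_neq0.
move=> eq_tu; apply: (mulIf tu); rewrite -eq_tu.
by rewrite !expr2 mulrACA [u * t]mulrC.
Qed.

Variables (a b : AA) (m : F).
Hypothesis sa : supported_in K a.
Hypothesis sb : supported_in K b.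
Hypothesis star_a : star a = a.
Hypothesis star_b : star b = b.
Hypothesis def_d : d = a * b.
Hypothesis m_neq0 : m != 0.
Hypothesis acb : a * c * b = m *: c.

(** Applying star turns the ideal of d = a b into that of b a. *)
Lemma conj_sum_d_mul_ba : b * a * conj_sum K d = u ^+ 2 *: (b * a).
Proof.
have Fd := @conj_sum_centralizes _ _ K d.
have: star (d * conj_sum K d) = star (u ^+ 2 *: d) by rewrite mul_d_conj_sum.
rewrite starM (star_centralizes inv_conj Fd) {2}def_d starM star_a star_b.
have -> : star (u ^+ 2 *: d) = u ^+ 2 *: star d by apply/ffunP=> g; rewrite !ffunE.
rewrite def_d starM star_a star_b -def_d => <-.
by rewrite (supported_comm _ Fd) //; apply: supportedM.
Qed.

(** The sum of the K-conjugates of c lies in the isotypic component of d: for y in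
    the centralizer of K, a c b y has the same trace as c y (b a), and b a lies in
    that component. *)
Lemma conj_sum_mul_conj_sum : conj_sum K c * conj_sum K d = u ^+ 2 *: conj_sum K c.
Proof.
have Fd := @conj_sum_centralizes _ _ K d.
apply/eqP; rewrite -subr_eq0; apply/eqP.
apply: (@centralizes_eq0 _ _ K) => [|y iy].
  apply: centralizesB; first by apply: centralizesM => //; apply: conj_sum_centralizes.
  by apply: centralizesZ; apply: conj_sum_centralizes.
rewrite -conj_sum_mulr // -conj_sumZ mulrBl galg_subE !trace_conj_sum // -mulrBr.
suff -> : (c * conj_sum K d * y) 1%g = (u ^+ 2 *: c * y) 1%g by rewrite subrr mulr0.
have rot w : centralizes K w -> m * (c * w) 1%g = (c * w * (b * a)) 1%g.
  move=> iw; rewrite -galg_scaleE scalerAl -acb -[a * c * b * w]mulrA.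
  rewrite (supported_comm sb iw).
  by rewrite -[a * c * _]mulrA galg_traceC !mulrA.
have iFy : centralizes K (conj_sum K d * y) by apply: centralizesM.
apply: (mulfI m_neq0); rewrite -scalerAl galg_scaleE [RHS]mulrCA.
rewrite -[c * _ * y]mulrA (rot _ iFy) (rot _ iy).
have sba : supported_in K (b * a) by apply: supportedM.
rewrite -![c * _ * (b * a)]mulrA.
rewrite -(supported_comm sba iFy) -(supported_comm sba iy).
by rewrite [b * a * _]mulrA conj_sum_d_mul_ba -scalerAl -scalerAr galg_scaleE.
Qed.

Lemma conj_sum_dcd : conj_sum K (d * c * d) = u ^+ 2 *: conj_sum K c.
Proof.
have Fd := @conj_sum_centralizes _ _ K d.
have u2 : u ^+ 2 != 0 by rewrite expf_neq0.
apply: (scalerI u2); rewrite -[in RHS]conj_sum_mul_conj_sum.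
have uAvC x : u *: conj_sum K (x * d) = conj_sum K (d * x * d).
  by rewrite -[d * x * d]mulrA -(conj_sumC (x * d) sd) -mulrA dd -scalerAr conj_sumZ.
have sumE : c * conj_sum K d = \sum_(k in K) c * gelt F k^-1%g * d * gelt F k.
  by rewrite mulr_sumr; apply: eq_bigr => k _; rewrite !mulrA.
have u2E : u ^+ 2 = (c * conj_sum K d) 1%g.
  rewrite trace_mul_cd ?mul_d_conj_sum; last first.
    apply: supported_sum => k Kk; do 2?apply: supportedM => //.
      by apply: supported_gelt; rewrite groupV.
    exact: supported_gelt.
  by case: qp_d => _ d1 *; rewrite galg_scaleE d1 mulr1.
rewrite -conj_sum_mulr // {1}u2E sumE galg_sumE conj_sum_sum scaler_suml scaler_sumr.
apply: eq_bigr => k Kk.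
have -> : c * gelt F k^-1%g * d * gelt F k =
    gelt F k^-1%g * (gelt F k * c * gelt F k^-1%g * d) * gelt F k.
  by rewrite !mulrA geltVl mul1r.
rewrite conj_sumJ // expr2 -scalerA uAvC -[RHS]conj_sumZ !mulrA corner_line conj_sumZ.
by rewrite geltVl mul1r.
Qed.

(** The left side is the convolution of the two characters, up to scalars. *)
Theorem isotypic_product : conj_sum [set: gT] c * conj_sum K d = (t * u) *: conj_sum K c.
Proof.
have u2 : u ^+ 2 != 0 by rewrite expf_neq0.
have iE : centralizes K E by move=> k Kk; rewrite isotypic_central.
apply: (scalerI u2).
rewrite -conj_sum_mull // -conj_sumZ isotypic_mul_d conj_sumZ conj_sum_dcd.
by rewrite trace_isotypic_mul_d !scalerA mulrC.
Qed.

End SphericalFunction.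

(** * Tableaux and Young symmetrizers *)

Section Tableaux.

Variable (T : finType).
Implicit Types (A : {set T}) (x y : T) (g p q s : {perm T}) (f r c : T -> nat).

Definition level_stab A f : {set {perm T}} :=
  [set s in perm.Sym A | [forall x in A, f (s x) == f x]].

Lemma level_stabP A f s :
  reflect (perm_on A s /\ {in A, forall x, f (s x) = f x}) (s \in level_stab A f).
Proof.
rewrite inE [s \in _]inE; apply: (iffP andP) => -[sA].
  by move/forall_inP=> fs; split=> // x /fs/eqP.
by move=> fs; split=> //; apply/forall_inP=> x /fs->.
Qed.

Lemma level_stab_group_set A f : group_set (level_stab A f).
Proof.
apply/group_setP; split=> [|s s' /level_stabP[sA fs] /level_stabP[sA' fs']].
  by apply/level_stabP; split=> [|x _]; rewrite ?perm_on1 ?perm1.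
apply/level_stabP; split=> [|x Ax]; first exact: perm_onM.
by rewrite permM fs' ?fs // (perm_closed _ sA).
Qed.

Canonical level_stab_group A f := Group (level_stab_group_set A f).

Lemma level_stab_sub A f : level_stab A f \subset perm.Sym A.
Proof. by apply/subsetP=> s; rewrite inE => /andP[]. Qed.

Lemma tperm_level_stab A f x y : x \in A -> y \in A -> f x = f y ->
  tperm x y \in level_stab A f.
Proof.
move=> Ax Ay fxy; apply/level_stabP; split.
  apply/subsetP=> z; rewrite inE; case: tpermP => [->|->|] //.
  by rewrite eqxx.
by move=> z _; case: tpermP => [->|->|].
Qed.

Lemma perm_of_rel A (P : T -> T -> Prop) :
    (forall x, x \in A -> exists2 y, y \in A & P x y) ->
    {in A &, forall x x' y, P x y -> P x' y -> x = x'} ->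
  exists2 s, perm_on A s & {in A, forall x, P x (s x)}.
Proof.
move=> exP injP.
have tgt x : exists y, [/\ (y \in A) = (x \in A), x \notin A -> y = x &
    x \in A -> P x y].
  have [Ax|Ax] := boolP (x \in A); last by exists x; rewrite (negPf Ax).
  by have [y Ay Pxy] := exP x Ax; exists y; rewrite Ay.
have [f fP] := fin_all_exists tgt.
have fA x : (f x \in A) = (x \in A) by have [] := fP x.
have fN x : x \notin A -> f x = x by have [] := fP x.
have fPx x : x \in A -> P x (f x) by have [] := fP x.
have f_inj : injective f.
  move=> x y eq_f; have := fA x; rewrite eq_f fA => eqA.
  have [Ay|Ay] := boolP (y \in A); last by rewrite -(fN _ Ay) -eq_f fN // -eqA.
  have Ax : x \in A by rewrite -eqA.
  by apply: (injP x y Ax Ay (f x)); [apply: fPx | rewrite eq_f; apply: fPx].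
exists (perm f_inj) => [|x Ax]; last by rewrite permE; apply: fPx.
apply/subsetP=> x; rewrite inE permE; apply: contraR => Ax.
by rewrite fN.
Qed.

Definition is_tableau A (lam : seq nat) r c : Prop :=
  [/\ {in A &, forall x y, r x = r y -> c x = c y -> x = y},
      {in A, forall x, in_frame lam (r x, c x)}
    & forall b, in_frame lam b -> exists2 x, x \in A & (r x, c x) = b].

Section Factor.

Variables (A : {set T}) (lam : seq nat) (r c : T -> nat).
Hypothesis tabA : is_tableau A lam r c.
Variable g : {perm T}.
Hypothesis gA : perm_on A g.
Hypothesis cg_inj : {in A &, forall x y, r x = r y -> c (g x) = c (g y) -> x = y}.

Let row_cut f i k : {set T} := [set x in A | (r x == i) && (f x < k)%N].

Let row_cut_le i k :
  (#|row_cut (fun x => c (g x)) i k| <= #|row_cut c i k|)%N.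
Proof.
have [_ frA surjA] := tabA.
have [le_k|lt_k] := leqP (nth 0%N lam i) k.
  apply/subset_leq_card/subsetP=> x; rewrite !inE => /and3P[Ax /eqP rx _].
  by rewrite Ax rx eqxx (leq_trans _ le_k) // -rx; apply: frA.
apply: (@leq_trans k).
  rewrite cardE -(size_map (fun x => c (g x))) -[X in (_ <= X)%N](size_iota 0).
  apply: uniq_leq_size => [|j].
    rewrite map_inj_in_uniq ?enum_uniq // => x y.
    rewrite !mem_enum !inE => /and3P[Ax /eqP rx _] /and3P[Ay /eqP ry _].
    by apply: cg_inj; rewrite ?rx.
  by case/mapP=> x; rewrite mem_enum inE mem_iota => /and3P[_ _ ?] ->.
rewrite cardE -(size_map c) -[X in (X <= _)%N](size_iota 0).
apply: uniq_leq_size => [|j]; first exact: iota_uniq.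
rewrite mem_iota /= add0n => lt_j.
have [|x Ax [rx cx]] := surjA (i, j); first exact: ltn_trans lt_j lt_k.
by apply/mapP; exists x; rewrite // mem_enum inE Ax rx eqxx cx.
Qed.

Let row_lt x : x \in A -> (r x < size lam)%N.
Proof.
have [_ frA _] := tabA; move/frA; apply: contraTT; rewrite -leqNgt => le_r.
by rewrite /in_frame /= nth_default.
Qed.

Let card_cut f k :
  #|[set x in A | (f x < k)%N]| = (\sum_(i < size lam) #|row_cut f i k|)%N.
Proof.
have Ax x : x \in [set x in A | (f x < k)%N] -> (r x < size lam)%N.
  by rewrite inE => /andP[/row_lt].
rewrite -sum1_card.
case: lam Ax => [|m l] Ax /=.
  rewrite big_ord0 big1 // => x /Ax; rewrite ltn0 //.
rewrite (partition_big (fun x => inord (r x) : 'I_(size l).+1) xpredT) //=.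
apply: eq_bigr => i _.
rewrite -sum1_card; apply: eq_bigl => x; rewrite !inE.
case: (boolP (x \in A)) => //= xA.
case: (boolP (f x < k)%N) => /= fk; last by rewrite andbF.
by rewrite andbT -val_eqE /= inordK // Ax // inE xA.
Qed.

Let card_col k :
  #|[set x in A | (c (g x) < k)%N]| = #|[set x in A | (c x < k)%N]|.
Proof.
rewrite -(card_imset _ (@perm_inj _ g)); apply: eq_card => y.
rewrite inE; apply/imsetP/andP=> [[x]|[Ay cy]].
  by rewrite inE => /andP[Ax cx] ->; rewrite (perm_closed _ gA).
exists (g^-1 y)%g; rewrite ?permKV // inE permKV cy.
by rewrite (perm_closed _ (perm_onV gA)) Ay.
Qed.

(** In each row at most as many points have their g-image in the first k columns
    as lie there themselves, because the images are in distinct columns. Summed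
    over the rows the counts agree, as g is a bijection, so they agree in each
    row; take for k the length of the row of x. *)
Lemma factor_in_frame x : x \in A -> in_frame lam (r x, c (g x)).
Proof.
move=> Ax; have [_ frA _] := tabA.
set i := r x; set k := nth 0%N lam i.
have eq_sum := card_col k; rewrite !card_cut in eq_sum.
have /leqif_sum := fun (j : 'I_(size lam)) (_ : true) =>
  leqif_eq (row_cut_le j k).
case=> _; rewrite eq_sum eqxx => /esym/forallP/(_ (Ordinal (row_lt Ax))) /= /eqP.
have -> : row_cut c (r x) k = [set y in A | r y == i].
  apply/setP=> y; rewrite !inE; case: (boolP (y \in A)) => //= Ay.
  by case: eqP => //= ry; rewrite /k /i -ry; apply: frA.
move=> eq_card; have: x \in row_cut (fun x => c (g x)) (r x) k.
  suff -> : row_cut (fun x => c (g x)) (r x) k = [set y in A | r y == i].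
    by rewrite inE Ax eqxx.
  apply/eqP; rewrite eqEcard eq_card leqnn andbT.
  by apply/subsetP=> y; rewrite !inE => /and3P[-> ->].
by rewrite inE => /and3P[].
Qed.

(** The permutation p moves x within its row to the column of g x. *)
Lemma row_col_factor : exists p q,
  [/\ p \in level_stab A r, q \in level_stab A c & g = (p * q)%g].
Proof.
have [_ _ surjA] := tabA.
have [x Ax|x x' Ax Ax' y [rx cx] [rx' cx']|p pA prc] :=
    @perm_of_rel A (fun x y => r y = r x /\ c y = c (g x)).
- by have [y Ay [ry cy]] := surjA _ (factor_in_frame Ax); exists y.
- by apply: cg_inj; rewrite -?rx -?cx.
exists p, (p^-1 * g)%g; rewrite mulKVg; split=> //.
  by apply/level_stabP; split=> // x /prc[].
apply/level_stabP; split=> [|y Ay]; first by apply: perm_onM; rewrite ?perm_onV.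
have Ax : (p^-1 y)%g \in A by rewrite (perm_closed _ (perm_onV pA)).
by have [_ cx] := prc _ Ax; rewrite permM -cx permKV.
Qed.

End Factor.

Local Notation AA := (galg algC {perm T}).

Definition sym_sum (S : {set {perm T}}) : AA := \sum_(s in S) gelt _ s.

Definition alt_sum (S : {set {perm T}}) : AA :=
  \sum_(s in S) (-1) ^+ s *: gelt _ s.

Definition young A r c : AA :=
  sym_sum (level_stab A r) * alt_sum (level_stab A c).

Lemma sym_sumE S g : sym_sum S g = (g \in S)%:R.
Proof.
rewrite galg_sumE; have [Sg|Sg] := boolP (g \in S).
  rewrite (bigD1 g) //= big1 ?addr0 ?ffunE ?eqxx // => h /andP[_ /negPf ne].
  by rewrite ffunE eq_sym ne.
by rewrite big1 // => h Sh; rewrite ffunE; case: eqP => // gh; rewrite gh Sh in Sg.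
Qed.

Lemma alt_sumE S g : alt_sum S g = (-1) ^+ g * (g \in S)%:R.
Proof.
rewrite -sym_sumE !galg_sumE mulr_sumr; apply: eq_bigr => s _.
rewrite galg_scaleE ffunE; case: eqP => [->|_] //.
by rewrite !mulr0.
Qed.

Lemma star_sym_sum (G : {group {perm T}}) : star (sym_sum G) = sym_sum G.
Proof. by apply/ffunP=> g; rewrite starE !sym_sumE groupV. Qed.

Lemma star_alt_sum (G : {group {perm T}}) : star (alt_sum G) = alt_sum G.
Proof. by apply/ffunP=> g; rewrite starE !alt_sumE groupV odd_permV. Qed.

Lemma sym_sum_gelt (G : {group {perm T}}) p :
  p \in G -> gelt _ p * sym_sum G = sym_sum G.
Proof.
move=> Gp; apply/ffunP=> g; rewrite galg_geltl !sym_sumE.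
by rewrite groupMl ?groupV.
Qed.

Lemma alt_sum_gelt (G : {group {perm T}}) q :
  q \in G -> alt_sum G * gelt _ q = (-1) ^+ q *: alt_sum G.
Proof.
move=> Gq; apply/ffunP=> g; rewrite galg_geltr galg_scaleE !alt_sumE.
rewrite groupMr ?groupV // mulrA; congr (_ * _).
by rewrite odd_permM odd_permV signr_addb mulrC.
Qed.

Lemma sym_sum_sub (H G : {group {perm T}}) :
  H \subset G -> sym_sum H * sym_sum G = #|H|%:R *: sym_sum G.
Proof.
move/subsetP=> sHG; rewrite {1}/sym_sum mulr_suml scaler_nat -sumr_const.
by apply: eq_bigr => h /sHG; apply: sym_sum_gelt.
Qed.

Lemma alt_sum_sub (H G : {group {perm T}}) :
  H \subset G -> alt_sum G * alt_sum H = #|H|%:R *: alt_sum G.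
Proof.
move/subsetP=> sHG; rewrite {2}/alt_sum mulr_sumr scaler_nat -sumr_const.
apply: eq_bigr => h /sHG Gh.
by rewrite -scalerAr alt_sum_gelt // scalerA -expr2 sqrr_sign scale1r.
Qed.

Lemma supported_sym_sum (S S' : {set {perm T}}) :
  S \subset S' -> supported_in S' (sym_sum S).
Proof.
by move/subsetP=> sS g /negP S'g; rewrite sym_sumE; case: (boolP (g \in S)) => // /sS.
Qed.

Lemma supported_alt_sum (S S' : {set {perm T}}) :
  S \subset S' -> supported_in S' (alt_sum S).
Proof.
move/subsetP=> sS g /negP S'g; rewrite alt_sumE.
by case: (boolP (g \in S)) => [/sS|] //; rewrite mulr0.
Qed.

Lemma supported_young A r c : supported_in (perm.Sym A) (young A r c).
Proof.
apply: (@supportedM _ _ (perm.Sym_group A)).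
  exact/supported_sym_sum/level_stab_sub.
exact/supported_alt_sum/level_stab_sub.
Qed.

Lemma youngE A r c g :
  young A r c g = \sum_(p in level_stab A r)
     (-1) ^+ (p^-1 * g)%g * ((p^-1 * g)%g \in level_stab A c)%:R.
Proof.
rewrite galgE [RHS]big_mkcond; apply: eq_bigr => p _.
by rewrite sym_sumE alt_sumE; case: ifP; rewrite ?mul1r ?mul0r.
Qed.

Section VonNeumann.

Variables (A : {set T}) (lam : seq nat) (r c : T -> nat).
Hypothesis tabA : is_tableau A lam r c.

Lemma row_col_stab1 s : s \in level_stab A r -> s \in level_stab A c -> s = 1%g.
Proof.
case/level_stabP=> sA rs /level_stabP[_ cs]; have [injA _ _] := tabA.
apply/permP=> x; rewrite perm1; have [Ax|Ax] := boolP (x \in A).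
  by apply: injA; rewrite ?(perm_closed _ sA) ?rs ?cs.
exact: out_perm sA Ax.
Qed.

Lemma young1 : young A r c 1%g = 1.
Proof.
rewrite youngE (bigD1 1%g) ?group1 //= invg1 mulg1 group1 odd_perm1 mulr1 big1 ?addr0 //.
move=> p /andP[Rp]; rewrite mulg1 groupV.
by case: (boolP (p \in _)) => [/(row_col_stab1 Rp) ->|_]; rewrite ?eqxx ?mulr0.
Qed.

Section Unique.

Variable z : AA.
Hypothesis sz : supported_in (perm.Sym A) z.
Hypothesis zR : forall p, p \in level_stab A r -> gelt _ p * z = z.
Hypothesis zC : forall q, q \in level_stab A c -> z * gelt _ q = (-1) ^+ q *: z.

Lemma equivariant_mul p g q : p \in level_stab A r -> q \in level_stab A c ->
  z (p * g * q)%g = (-1) ^+ q * z g.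
Proof.
move=> Rp Cq; have /ffunP/(_ (p * g * q)%g) := zC Cq.
rewrite galg_geltr galg_scaleE mulgK -[in z (p * g)%g](zR Rp) galg_geltl mulKg => ->.
by rewrite mulrA -expr2 sqrr_sign mul1r.
Qed.

(** If g is not in R C then some transposition t in R satisfies
    g^-1 t g in C, and the two symmetries of z force z g = - z g. *)
Lemma equivariant_eq0 x y g : x \in A -> y \in A -> perm_on A g -> x != y ->
  r x = r y -> c (g x) = c (g y) -> z g = 0.
Proof.
move=> Ax Ay gA nxy rxy cxy.
have Rt := tperm_level_stab Ax Ay rxy.
have Ct : tperm (g x) (g y) \in level_stab A c.
  by apply: tperm_level_stab; rewrite // (perm_closed _ gA).
have := equivariant_mul g Rt Ct.
have -> : (tperm x y * g * tperm (g x) (g y))%g = g.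
  by rewrite -tpermJ conjgE !mulgA mulgK tperm2 mul1g.
rewrite odd_tperm (inj_eq perm_inj) nxy expr1 mulN1r => /eqP.
by rewrite -addr_eq0 -mulr2n mulrn_eq0 => /eqP.
Qed.

End Unique.

Lemma young_row p : p \in level_stab A r -> gelt _ p * young A r c = young A r c.
Proof. by move=> Rp; rewrite mulrA sym_sum_gelt. Qed.

Lemma young_col q : q \in level_stab A c ->
  young A r c * gelt _ q = (-1) ^+ q *: young A r c.
Proof. by move=> Cq; rewrite -mulrA alt_sum_gelt // scalerAr. Qed.

(** Both sides are determined on R C by the value at 1, and vanish elsewhere by
    [row_col_factor] and [equivariant_eq0]. *)
Lemma young_unique z : supported_in (perm.Sym A) z ->
    (forall p, p \in level_stab A r -> gelt _ p * z = z) ->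
    (forall q, q \in level_stab A c -> z * gelt _ q = (-1) ^+ q *: z) ->
  z = z 1%g *: young A r c.
Proof.
move=> sz zR zC; apply/ffunP=> g; rewrite galg_scaleE.
have [gA|gA] := boolP (perm_on A g); last first.
  have gS : g \notin perm.Sym A by rewrite inE.
  by rewrite (sz _ gS) (@supported_young A r c _ gS) mulr0.
case: (boolP [exists x in A, [exists y in A,
    [&& x != y, r x == r y & c (g x) == c (g y)]]]).
  case/exists_inP=> x Ax /exists_inP[y Ay /and3P[nxy /eqP rxy /eqP cxy]].
  rewrite (equivariant_eq0 zR zC Ax Ay) //.
  by rewrite (equivariant_eq0 young_row young_col Ax Ay) ?mulr0.
move/exists_inPn=> no_pair.
have [|p [q [Rp Cq ->]]] := row_col_factor tabA gA.
  move=> x y Ax Ay rxy cxy; apply: contraTeq isT => nxy.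
  have /exists_inPn/(_ y Ay) := no_pair x Ax.
  by rewrite nxy rxy cxy !eqxx.
rewrite -(mulg1 p) (equivariant_mul zR zC) //.
by rewrite (equivariant_mul young_row young_col) // young1 mulr1 mulrC.
Qed.

Lemma young_sandwich (x : AA) : supported_in (perm.Sym A) x ->
  exists a : algC, young A r c * x * young A r c = a *: young A r c.
Proof.
move=> sx; eexists; apply: young_unique => [|p Rp|q Cq].
- have sy := @supported_young A r c.
  by apply: (@supportedM _ _ (perm.Sym_group A) (_ * x)) => //; apply: supportedM.
- by rewrite mulrA [gelt _ p * (_ * x)]mulrA young_row.
- by rewrite -[LHS]mulrA young_col // -scalerAr.
Qed.

Lemma young_quasi_primitive t : t != 0 ->
  young A r c * young A r c = t *: young A r c ->
  quasi_primitive (perm.Sym A) (young A r c) t.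
Proof.
move=> t0 cc; split=> //; first exact: supported_young.
  exact: young1.
exact: young_sandwich.
Qed.

End VonNeumann.

End Tableaux.

(** * Characters of Specht modules *)

Lemma standard_tableau (T : finType) (A : {set T}) lam :
  sumn lam = #|A| -> is_tableau A lam (tab_row A lam) (tab_col A lam).
Proof.
move=> sum_lam; split=> [x y Ax Ay rxy cxy|x Ax|[i j] ltj].
- have : index x (enum A) = index y (enum A).
    rewrite -(reshape_indexK lam (index x _)) -(reshape_indexK lam (index y _)).
    by congr flatten_index.
  move/(congr1 (nth x (enum A))).
  by rewrite !nth_index ?mem_enum.
- by apply: reshape_offsetP; rewrite sum_lam cardE index_mem mem_enum.
have lt_k := flatten_indexP ltj; set k := flatten_index lam i j in lt_k.
have [x0 Ax0] : exists x0, x0 \in A.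
  by apply/set0Pn; rewrite -card_gt0 -sum_lam; apply: leq_ltn_trans lt_k.
rewrite sum_lam cardE in lt_k.
exists (nth x0 (enum A) k); first by rewrite -mem_enum mem_nth.
rewrite /tab_row /tab_col index_uniq ?enum_uniq //.
by rewrite flatten_indexKl // flatten_indexKr.
Qed.

Section RegularRow.

Variables (F : fieldType) (gT : finGroupType) (G : {group gT}).
Local Notation AA := (galg F gT).
Local Notation aG := (regular_repr F G).
Implicit Types (x y : AA).

Definition regular_row x : 'rV[F]_#|G| := \row_i x (enum_val i).

(** Left multiplication by x, as an operator on row vectors: it commutes with
    the regular representation, which acts by right multiplication. *)
Definition regular_lmul x : 'M[F]_#|G| :=
  \matrix_i regular_row (x * gelt F (enum_val i)).

Lemma regular_row_gelt g : g \in G ->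
  regular_row (gelt F g) = delta_mx 0 (gring_index G g).
Proof.
move=> Gg; apply/rowP=> i; rewrite !mxE ffunE eqxx /=.
by rewrite -(inj_eq enum_val_inj) gring_indexK.
Qed.

Lemma regular_row_linear a x y :
  regular_row (a *: x + y) = a *: regular_row x + regular_row y.
Proof. by apply/rowP=> i; rewrite !mxE !ffunE. Qed.

HB.instance Definition _ := GRing.isLinear.Build F AA 'rV[F]_#|G| *:%R
  regular_row regular_row_linear.

Lemma regular_rowM x g : supported_in G x -> g \in G ->
  regular_row x *m aG g = regular_row (x * gelt F g).
Proof.
move=> sx Gg; rewrite {1 2}(supported_expand sx) mulr_suml !linear_sum mulmx_suml.
apply: eq_bigr => h Gh; rewrite -scalerAl -geltM !linearZ /= -scalemxAl.
rewrite !regular_row_gelt ?groupM //; congr (_ *: _).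
by rewrite -rowE rowK gring_indexK.
Qed.

Lemma regular_lmulE x y : supported_in G y ->
  regular_row y *m regular_lmul x = regular_row (x * y).
Proof.
move=> sy; rewrite {1 2}(supported_expand sy) mulr_sumr !linear_sum mulmx_suml.
apply: eq_bigr => h Gh; rewrite -scalerAr !linearZ /= -scalemxAl.
rewrite regular_row_gelt //; congr (_ *: _).
by rewrite -rowE rowK gring_indexK.
Qed.

Section Cyclic.

Variable c : AA.
Hypothesis sc : supported_in G c.
Variable t : F.
Hypothesis cc : c * c = t *: c.

Let U := cyclic_mx aG (regular_row c).
Let L := regular_lmul c.

Let supported_c_gelt g : g \in G -> supported_in G (c * gelt F g).
Proof. by move=> Gg; apply: supportedM => //; apply: supported_gelt. Qed.

Let row_L g : g \in G -> row (gring_index G g) L = regular_row (c * gelt F g).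
Proof. by move=> Gg; rewrite rowK gring_indexK. Qed.

Let eq_UL : (U :=: L)%MS.
Proof.
apply/eqmxP/andP; split.
  apply: cyclic_mx_sub; last first.
    by rewrite -[c]mulr1 -gelt1 -row_L // row_sub.
  apply/mxmoduleP=> g Gg; apply/row_subP=> i; rewrite row_mul rowK.
  have Gi := enum_valP i.
  rewrite regular_rowM //; last exact: supported_c_gelt.
  rewrite -mulrA -geltM -row_L ?groupM //.
  exact: row_sub.
apply/row_subP=> i; rewrite rowK -regular_rowM ?enum_valP //.
by rewrite mxmodule_trans ?cyclic_mx_module ?cyclic_mx_id ?enum_valP.
Qed.

Let L_idem : L *m L = t *: L.
Proof.
apply/row_matrixP=> i; rewrite row_mul linearZ /= rowK.
rewrite regular_lmulE; last exact/supported_c_gelt/enum_valP.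
rewrite mulrA cc -scalerAl.
by rewrite linearZ.
Qed.

(** Left multiplication by c is t times a projector onto the right ideal
    generated by c, and it commutes with right multiplication by g, so t times
    the trace of g on that ideal is the trace of x |-> c x g on the whole
    regular representation. *)
Lemma cyclic_repr_trace g : g \in G ->
  t * \tr (submod_repr (cyclic_mx_module aG (regular_row c)) g)
    = \sum_(x in G) c (x * g^-1 * x^-1)%g.
Proof.
move=> Gg; rewrite -/U.
have BL : t *: val_submod (U := U) 1%:M = val_submod 1%:M *m L.
  have /submxP[W ->] : (val_submod (U := U) 1%:M <= L)%MS.
    by rewrite val_submod1 eq_UL.
  by rewrite -mulmxA L_idem scalemxAr.
rewrite -mxtraceZ /= /submod_mx -linearZ /= scalemxAl BL in_submodE.
rewrite -[_ *m L *m _]mulmxA -mulmxA mxtrace_mulC -val_submodE -in_submodE.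
rewrite in_submodK; last first.
  by apply: mxmodule_trans => //; [apply: cyclic_mx_module | rewrite eq_UL].
rewrite big_enum_val; apply: eq_bigr => i _.
have -> j : (L *m regular_mx F G g) i j = (row i L *m aG g) 0 j.
  by rewrite -row_mul [RHS]mxE.
rewrite rowK regular_rowM //; last exact/supported_c_gelt/enum_valP.
by rewrite mxE !galg_geltr.
Qed.

(** In the trace formula at g = 1 the right side is #|G|. *)
Lemma cyclic_scalar_neq0 : #|G|%:R != 0 :> F -> c 1%g = 1 -> t != 0.
Proof.
move=> nzG c1; apply: contraNneq nzG => t0.
have := cyclic_repr_trace (group1 G); rewrite t0 mul0r => /esym.
under eq_bigr do rewrite invg1 mulg1 mulgV c1.
by rewrite sumr_const => ->.
Qed.

End Cyclic.

End RegularRow.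

Section SpechtCharacter.

Variables (T : finType) (A : {set T}) (lam : seq nat).
Hypothesis sum_lam : sumn lam = #|A|.

Let c := young A (tab_row A lam) (tab_col A lam).

Lemma young_symmetrizer_row :
  young_symmetrizer A lam = regular_row (perm.Sym_group A) c.
Proof.
rewrite /c /young /sym_sum /alt_sum mulr_suml linear_sum; apply: eq_bigr => p Rp.
rewrite mulr_sumr linear_sum; apply: eq_bigr => q Cq.
rewrite -scalerAr -geltM linearZ /=; congr (_ *: _).
rewrite regular_row_gelt // groupM //=.
  exact: (subsetP (level_stab_sub _ _) _ Rp).
exact: (subsetP (level_stab_sub _ _) _ Cq).
Qed.

(** The scalar t is the order of the group divided by the degree. *)
Lemma specht_charE : exists2 t : algC, quasi_primitive (perm.Sym A) c t &
  forall g, g \in perm.Sym A ->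
    (specht_char A lam g)^* = t^-1 * conj_sum (perm.Sym_group A) c g.
Proof.
have tabA := standard_tableau sum_lam.
have sc := @supported_young T A (tab_row A lam) (tab_col A lam).
have [x|t] := @young_sandwich _ _ _ _ _ tabA 1.
  by move=> Ax; rewrite -gelt1 ffunE; case: eqP Ax => // ->; rewrite group1.
rewrite mulr1 => cc.
have t0 : t != 0.
  apply: (cyclic_scalar_neq0 sc cc); last exact: (young1 tabA).
  by rewrite pnatr_eq0 -lt0n cardG_gt0.
exists t => [|g Ag]; first exact: (young_quasi_primitive tabA).
apply: (mulfI t0); rewrite mulVKf //.
rewrite -char_inv ?cfRepr_char // /specht_char cfunE groupV Ag mulr1n.
rewrite /specht_repr young_symmetrizer_row (cyclic_repr_trace sc cc) ?groupV //.
rewrite galg_sumE invgK; apply: eq_bigr => x _.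
by rewrite galg_geltr galg_geltl invgK mulgA.
Qed.

End SpechtCharacter.

(** * Conjugating and restricting tableaux *)

Section InverseConjugate.

Variables (T : finType) (x0 : T) (g : {perm T}).

Let orbit_rep (S : {set T}) := if x0 \in S then x0 else odflt x0 [pick y in S].

Let orbit_rep_mem x : x \in porbit g (orbit_rep (porbit g x)).
Proof.
rewrite -eq_porbit_mem eq_sym eq_porbit_mem /orbit_rep; case: ifP => // _.
by case: pickP => [//|/(_ x)]; rewrite porbit_id.
Qed.

Let expg_inv_eq i j x : (g ^+ i)%g x = (g ^+ j)%g x ->
  ((g ^+ i)^-1)%g x = ((g ^+ j)^-1)%g x.
Proof.
move=> eq_ij; rewrite -[in RHS](permK (g ^+ i)%g x) eq_ij -!permM ?mulgA.
have -> : (g ^+ j * (g ^+ i)^-1 = (g ^+ i)^-1 * g ^+ j)%g.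
  exact/commuteV/commuteX2/commute_refl.
by rewrite mulgK.
Qed.

(** Reflect each cycle about one of its points, choosing x0 in the cycle of x0. *)
Lemma perm_inv_conj : exists2 k : {perm T}, k x0 = x0 & (g ^ k = g^-1)%g.
Proof.
have refl x : exists y, exists2 i, x = (g ^+ i)%g (orbit_rep (porbit g x)) &
    y = ((g ^+ i)^-1)%g (orbit_rep (porbit g x)).
  have /porbitP[i ?] := orbit_rep_mem x.
  by exists (((g ^+ i)^-1)%g (orbit_rep (porbit g x))), i.
have [f fP] := fin_all_exists refl.
have f_eq x i : x = (g ^+ i)%g (orbit_rep (porbit g x)) ->
    f x = ((g ^+ i)^-1)%g (orbit_rep (porbit g x)).
  have [j def_x ->] := fP x => def_x'; apply: expg_inv_eq.
  by rewrite -def_x -def_x'.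
have f_orbit x : porbit g (f x) = porbit g x.
  have [i _ ->] := fP x; rewrite -[LHS]porbitV -expgVn porbit_perm porbitV.
  by apply/eqP; rewrite eq_porbit_mem porbit_sym orbit_rep_mem.
have f_inj : injective f.
  move=> x y eq_f; have eq_orb : porbit g x = porbit g y.
    by rewrite -f_orbit eq_f f_orbit.
  move: eq_f; have [i def_x ->] := fP x; have [j def_y ->] := fP y.
  move: def_x def_y; rewrite eq_orb; move: (orbit_rep _) => z -> -> eq_z.
  rewrite -[in LHS](permK ((g ^+ j)^-1)%g z) -eq_z invgK -!permM ?mulgA.
  have -> : ((g ^+ i)^-1 * g ^+ j = g ^+ j * (g ^+ i)^-1)%g.
    exact/commute_sym/commuteV/commuteX2/commute_refl.
  by rewrite mulgKV.
have f_g x : f (g x) = (g^-1)%g (f x).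
  have porb_gx : porbit g (g x) = porbit g x by rewrite -{2}[g]expg1 porbit_perm.
  have [i def_x ->] := fP x.
  rewrite (f_eq _ i.+1) porb_gx; first by rewrite expgS invMg permM.
  by rewrite {1}def_x expgSr permM.
exists (perm f_inj).
  rewrite permE (f_eq _ 0%N) !expg0 ?invg1 perm1 /orbit_rep porbit_id //.
apply/permP=> y; rewrite -[y](permKV (perm f_inj)); set x := ((perm f_inj)^-1)%g y.
by rewrite permJ !(permE f_inj) f_g.
Qed.

End InverseConjugate.

Section TableauConjugation.

Variable T : finType.
Implicit Types (A B : {set T}) (r c f : T -> nat) (w p q s g : {perm T}).

Lemma eq_level_stab A f f' : {in A, f =1 f'} -> level_stab A f = level_stab A f'.
Proof.
move=> eqf; apply/setP=> s; apply/level_stabP/level_stabP=> -[sA fs]; split=> // x Ax.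
  by rewrite -!eqf ?fs ?(perm_closed _ sA).
by rewrite !eqf ?fs ?(perm_closed _ sA).
Qed.

Lemma level_stab_setT f (s : {perm T}) :
  reflect (forall x, f (s x) = f x) (s \in level_stab [set: T] f).
Proof.
apply: (iffP (level_stabP _ _ _)) => [[_ fs] x|fs]; first by rewrite fs ?inE.
by split=> [|x _]; [apply/subsetP=> x; rewrite inE | apply: fs].
Qed.

Lemma eq_is_tableau A lam r c r' c' : {in A, r =1 r'} -> {in A, c =1 c'} ->
  is_tableau A lam r c -> is_tableau A lam r' c'.
Proof.
move=> eqr eqc [inj_rc fr surj]; split=> [x y Ax Ay|x Ax|b /surj[x Ax rcx]].
- by rewrite -!eqr // -!eqc //; apply: inj_rc.
- by rewrite -eqr // -eqc //; apply: fr.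
by exists x; rewrite -?eqr -?eqc.
Qed.

Lemma tableau_unique A lam r0 c0 r c :
    is_tableau A lam r0 c0 -> is_tableau A lam r c ->
  exists2 w, perm_on A w & {in A, forall x, r x = r0 (w x) /\ c x = c0 (w x)}.
Proof.
move=> [_ _ surj0] [inj_rc fr _].
apply: (@perm_of_rel _ A (fun x y => r x = r0 y /\ c x = c0 y)) => [x Ax|].
  by have [y Ay [ry cy]] := surj0 _ (fr _ Ax); exists y.
move=> x x' Ax Ax' y [rx cx] [rx' cx'].
by apply: inj_rc; rewrite // ?rx ?cx.
Qed.

Lemma young_conj w r0 c0 r c :
    (forall x, r x = r0 (w x)) -> (forall x, c x = c0 (w x)) ->
  young [set: T] r c = gelt _ w * young [set: T] r0 c0 * gelt _ w^-1%g.
Proof.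
move=> rw cw.
have stab_conj f f0 : (forall x, f x = f0 (w x)) -> forall s,
    ((w^-1 * s * w)%g \in level_stab [set: T] f0) = (s \in level_stab [set: T] f).
  move=> fw s; apply/level_stab_setT/level_stab_setT=> fs x.
    by have := fs (w x); rewrite !permM permK -!fw.
  by rewrite !permM -fw fs fw permKV.
have symJ : sym_sum (level_stab [set: T] r) =
    gelt _ w * sym_sum (level_stab [set: T] r0) * gelt _ w^-1%g.
  apply/ffunP=> s; rewrite galg_geltr galg_geltl !sym_sumE invgK mulgA.
  by rewrite (stab_conj _ _ rw).
have altJ : alt_sum (level_stab [set: T] c) =
    gelt _ w * alt_sum (level_stab [set: T] c0) * gelt _ w^-1%g.
  apply/ffunP=> s; rewrite galg_geltr galg_geltl !alt_sumE invgK mulgA.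
  by rewrite (stab_conj _ _ cw) -[(w^-1 * s * w)%g]mulgA -conjgE odd_permJ.
rewrite /young symJ altJ !mulrA; congr (_ * _ * _).
by rewrite -!mulrA geltVl mulr1.
Qed.

(** In a tableau a point is determined by its row and its column, so it cannot
    be moved away within its row and back within a column. *)
Lemma row_col_fixed B lam r c p q x : is_tableau B lam r c ->
    p \in level_stab B r -> q \in level_stab B c -> q (p x) = x -> p x = x.
Proof.
case=> inj_rc _ _ /level_stabP[pB rp] /level_stabP[qB cq] qpx.
have [Bx|Bx] := boolP (x \in B); last exact: out_perm pB Bx.
have Bpx : p x \in B by rewrite (perm_closed _ pB).
by apply: inj_rc; rewrite ?rp // -cq ?qpx.
Qed.

Lemma row_col_perm_on A B lam r c p q : is_tableau B lam r c ->
    p \in level_stab B r -> q \in level_stab B c -> perm_on A (p * q)%g ->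
  perm_on A p /\ perm_on A q.
Proof.
move=> tabB Rp Cq pqA.
have pA : perm_on A p.
  apply/subsetP=> x; rewrite inE; apply: contraR => Ax.
  by apply/eqP; apply: (row_col_fixed tabB Rp Cq); rewrite -permM (out_perm pqA).
by split=> //; rewrite -(mulKg p q); apply: perm_onM; rewrite ?perm_onV.
Qed.

Lemma level_stab_subset A B f s : A \subset B ->
  (s \in level_stab A f) = perm_on A s && (s \in level_stab B f).
Proof.
move=> sAB; apply/level_stabP/andP=> [[sA fs]|[sA /level_stabP[_ fs]]]; split=> //.
  apply/level_stabP; split=> [|x Bx]; first exact: subset_trans sA sAB.
  by have [/fs|/(out_perm sA)->] := boolP (x \in A).
by move=> x Ax; apply/fs/(subsetP sAB).
Qed.

(** A factorization p q of a permutation that fixes the points outside A has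
    both factors of the same kind. *)
Lemma young_restrict A B lam r c g : is_tableau B lam r c -> A \subset B ->
  g \in perm.Sym A -> young B r c g = young A r c g.
Proof.
rewrite inE => tabB sAB gA; rewrite !youngE [LHS]big_mkcond [RHS]big_mkcond.
apply: eq_bigr => p _ /=.
rewrite !(level_stab_subset _ _ sAB).
case: (boolP (p \in level_stab B r)) => Rp; last by rewrite andbF.
case: (boolP (_ \in level_stab B c)) => Cq; last by rewrite andbF !mulr0 if_same.
have [|pA qA] := row_col_perm_on (A := A) tabB Rp Cq; first by rewrite mulKVg.
by rewrite pA qA.
Qed.

Lemma tableau_add_box A lam mu b x0 r c : removes_box lam mu b -> x0 \notin A ->
  (r x0, c x0) = b -> is_tableau A mu r c -> is_tableau (x0 |: A) lam r c.
Proof.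
case=> lam_b mu_lam Ax0 rc0 [inj_rc fr surj].
have neq0 x : x \in A -> (r x, c x) != b.
  by move/fr; rewrite mu_lam => /andP[].
split=> [x y|x|b' lam_b'].
- rewrite !inE => /orP[/eqP->|Ax] /orP[/eqP->|Ay] //; last exact: inj_rc.
    by move=> ry cy; have := neq0 _ Ay; rewrite -ry -cy rc0 eqxx.
  by move=> rx cx; have := neq0 _ Ax; rewrite rx cx rc0 eqxx.
- rewrite !inE => /orP[/eqP->|/fr]; first by rewrite rc0.
  by rewrite mu_lam => /andP[].
have [->|neq_b] := eqVneq b' b; first by exists x0; rewrite ?setU11.
have [|x Ax rcx] := surj b'; first by rewrite mu_lam lam_b' neq_b.
by exists x; rewrite // setU1r.
Qed.

End TableauConjugation.

(** * The generalized character as a sum of conjugate Young symmetrizers *)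

Lemma nonfirst_pointsE n : nonfirst_points n.+1 = [set~ ord0].
Proof. by apply/setP=> i; rewrite !inE -val_eqE lt0n. Qed.

Lemma Sym_nonfirstE n (k : 'S_n.+1) :
  (k \in perm.Sym (nonfirst_points n.+1)) = (k ord0 == ord0).
Proof.
rewrite inE nonfirst_pointsE; apply/subsetP/eqP=> [sk|k0 i].
  by apply/eqP/negbNE/negP=> /sk; rewrite !inE eqxx.
by rewrite !inE; apply: contraNneq => ->; rewrite k0.
Qed.

(** Replacing the standard tableau of shape lam by a conjugate one does not
    affect the character. The chosen one has the first point in the box b and
    restricts to the standard tableau of shape mu on the other points, so that
    its Young symmetrizer restricts to that of mu. *)
Lemma gen_char_conj_sum n lam mu b :
    is_part n.+1 lam -> is_part n mu -> removes_box lam mu b ->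
  exists r, exists c, [/\ is_tableau [set: 'I_n.+1] lam r c, (r ord0, c ord0) = b &
    forall theta, gen_char lam mu theta = (n`!)%:R^-1 *
      conj_sum (perm.Sym_group (nonfirst_points n.+1)) (young [set: 'I_n.+1] r c) theta].
Proof.
move=> /and3P[_ _ /eqP sum_lam] /and3P[_ _ /eqP sum_mu] rem_b.
set A := nonfirst_points n.+1; set K := perm.Sym_group A.
have card_A : #|A| = n by rewrite /A nonfirst_pointsE cardsC1 card_ord.
have sum_lamT : sumn lam = #|[set: 'I_n.+1]| by rewrite cardsT card_ord.
have sum_muA : sumn mu = #|A| by rewrite card_A.
pose r x := if x == ord0 then b.1 else tab_row A mu x.
pose c x := if x == ord0 then b.2 else tab_col A mu x.
have A0 x : x \in A -> (x == ord0) = false.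
  by rewrite /A nonfirst_pointsE !inE => /negPf.
have eq_r : {in A, tab_row A mu =1 r} by move=> x Ax; rewrite /r A0.
have eq_c : {in A, tab_col A mu =1 c} by move=> x Ax; rewrite /c A0.
have rc0 : (r ord0, c ord0) = b by rewrite /r /c eqxx; case: (b).
have tabA : is_tableau A mu r c.
  exact: eq_is_tableau eq_r eq_c (standard_tableau sum_muA).
have tabT : is_tableau [set: 'I_n.+1] lam r c.
  have -> : [set: 'I_n.+1] = ord0 |: A.
    by rewrite /A nonfirst_pointsE; apply/setP=> x; rewrite !inE orbN.
  apply: tableau_add_box rem_b _ rc0 tabA.
  by rewrite /A nonfirst_pointsE !inE eqxx.
exists r, c; split=> // theta.
have [t qp0 chi_lam] := specht_charE sum_lamT.
have [u qp_d chi_mu] := specht_charE sum_muA.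
set c0 := young _ _ _ in qp0 chi_lam; set d := young _ _ _ in qp_d chi_mu.
set cT := young _ _ _.
have [w _ rcw] := tableau_unique (standard_tableau sum_lamT) tabT.
have cTJ : cT = gelt _ w * c0 * gelt _ w^-1%g.
  by apply: young_conj => x; have [] := rcw x (in_setT x).
have inT g : g \in perm.Sym [set: 'I_n.+1].
  by rewrite inE; apply/subsetP=> x; rewrite inE.
have SymT : perm.Sym_group [set: 'I_n.+1] = [set: 'S_n.+1]%G.
  by apply/val_inj/setP=> g; rewrite /= inT inE.
have qp_c : quasi_primitive [set: 'S_n.+1] cT t.
  have [_ _ t0 cc _] := qp0.
  have := young_quasi_primitive tabT t0.
  have -> : perm.Sym [set: 'I_n.+1] = [set: 'S_n.+1].
    by apply/setP=> g; rewrite inT inE.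
  apply; rewrite -/cT cTJ; move: (c0) cc => z zz.
  rewrite !mulrA -[_ * gelt _ w^-1%g * _]mulrA geltVl mulr1.
  by rewrite -[_ * z * z]mulrA zz -scalerAr -scalerAl.
have def_d : d = young A r c.
  by rewrite /d /young (eq_level_stab eq_r) (eq_level_stab eq_c).
have inv_conj g : exists2 k, k \in K & (g ^ k = g^-1)%g.
  have [k k0 gk] := perm_inv_conj ord0 g.
  by exists k; rewrite // Sym_nonfirstE k0.
have eq_cd k : k \in K -> cT k = d k.
  by move=> Kk; rewrite def_d; apply: young_restrict tabT _ Kk; apply: subsetT.
have sR : level_stab A r \subset level_stab [set: 'I_n.+1] r.
  by apply/subsetP=> s; rewrite (level_stab_subset _ _ (subsetT A)) => /andP[].
have sC : level_stab A c \subset level_stab [set: 'I_n.+1] c.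
  by apply/subsetP=> s; rewrite (level_stab_subset _ _ (subsetT A)) => /andP[].
pose a := sym_sum (level_stab A r); pose a' := alt_sum (level_stab A c).
pose m := (#|level_stab A r| * #|level_stab A c|)%:R : algC.
have m0 : m != 0 by rewrite pnatr_eq0 muln_eq0 negb_or -!lt0n !cardG_gt0.
have acb : a * cT * a' = m *: cT.
  rewrite /cT /young mulrA sym_sum_sub // -mulrA -scalerAl alt_sum_sub //.
  by rewrite -scalerAr scalerA -natrM.
have prodE := isotypic_product inv_conj qp_c qp_d eq_cd
  (supported_sym_sum (level_stab_sub A r)) (supported_alt_sum (level_stab_sub A c))
  (star_sym_sum _) (star_alt_sum _) def_d m0 acb.
have EE : conj_sum [set: 'S_n.+1] c0 = conj_sum [set: 'S_n.+1] cT.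
  by rewrite cTJ -{1}[w]invgK conj_sumJ ?inE.
have [_ _ t0 _ _] := qp_c; have [_ _ u0 _ _] := qp_d.
rewrite /gen_char; congr (_ * _).
transitivity ((t * u)^-1 * (conj_sum [set: 'S_n.+1] cT * conj_sum K d) theta); last first.
  by rewrite prodE galg_scaleE mulKf // mulf_neq0.
rewrite galgE.
rewrite [X in _ * X](reindex_inj (mulgI theta)) [X in _ * X](bigID [in K]) /=.
rewrite [X in _ * (_ + X)]big1 ?addr0.
  rewrite mulr_sumr; apply: eq_bigr => h Kh.
  rewrite chi_lam // chi_mu // SymT EE invMg mulgKV.
  have Fd := @conj_sum_centralizes _ _ K d.
  rewrite -[in RHS](star_centralizes inv_conj Fd) starE invgK.
  by rewrite mulrACA -invfM.
move=> h Kh; rewrite invMg mulgKV.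
have -> : conj_sum K d h^-1%g = 0; last by rewrite mulr0.
have skd : supported_in K (conj_sum K d).
  have [sd _ _ _ _] := qp_d.
  apply: supported_sum => k Kk.
  by apply: (supportedM (supportedM _ sd)); apply: supported_gelt; rewrite ?groupV.
by apply: skd; rewrite groupV.
Qed.

Section InjectiveFillings.

Variables (T : finType) (A : {set T}).

Lemma injective_extend (f : T -> T) : {in A &, injective f} ->
  exists s : {perm T}, {in A, s =1 f}.
Proof.
move=> f_inj; pose B := ~: (f @: A).
have cardB : size (enum B) = size (enum (~: A)).
  by rewrite -!cardE [LHS]cardsCs [RHS]cardsCs !setCK card_in_imset.
pose e x := if x \in A then f x else nth x (enum B) (index x (enum (~: A))).
have lt_index x : x \notin A -> (index x (enum (~: A)) < size (enum B))%N.
  by move=> Ax; rewrite cardB index_mem mem_enum inE.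
have eB x : x \notin A -> e x \in B.
  by move=> Ax; rewrite /e (negPf Ax) -mem_enum mem_nth ?lt_index.
have eA x : x \in A -> e x \notin B.
  by move=> Ax; rewrite /e Ax inE negbK imset_f.
have e_inj : injective e.
  move=> x y; have [Ax|Ax] := boolP (x \in A); have [Ay|Ay] := boolP (y \in A).
  - by rewrite /e Ax Ay; apply: f_inj.
  - by move=> exy; have := eA x Ax; rewrite exy eB.
  - by move=> exy; have := eA y Ay; rewrite -exy eB.
  rewrite /e (negPf Ax) (negPf Ay) (set_nth_default y) ?lt_index // => /eqP.
  rewrite nth_uniq ?lt_index ?enum_uniq // => /eqP eq_ix.
  have := congr1 (nth x (enum (~: A))) eq_ix.
  by rewrite !nth_index ?mem_enum ?inE.
by exists (perm e_inj) => x Ax; rewrite permE /e Ax.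
Qed.

Definition cut_outside (s : {perm T}) : {ffun T -> T} :=
  [ffun x => if x \in A then s x else x].

Lemma card_cut_outside (f : {ffun T -> T}) :
    {in A &, injective f} -> {in ~: A, f =1 id} ->
  #|[set s | cut_outside s == f]| = (#|T| - #|A|)`!.
Proof.
move=> f_inj f_out; have [s0 s0f] := injective_extend f_inj.
have -> : [set s | cut_outside s == f] = (perm.Sym (~: A) :* s0)%g.
  apply/setP=> s; rewrite mem_rcoset !inE; apply/eqP/subsetP=> [sf x|sA].
    rewrite !inE; apply: contraNN => Ax; rewrite permM.
    by apply/eqP; apply: (canLR (permK s0)); rewrite s0f // -sf ffunE Ax.
  apply/ffunP=> x; rewrite ffunE; case: (boolP (x \in A)) => Ax; last first.
    by rewrite f_out ?inE.
  rewrite -s0f //; apply: (canRL (permKV s0)); rewrite -permM.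
  by apply/eqP/negbNE/negP=> /sA; rewrite inE Ax.
by rewrite card_rcoset perm.card_Sym [X in (X`!)%N]cardsCs setCK.
Qed.

End InjectiveFillings.

Section YoungSum.

Variable T : finType.
Implicit Types (A : {set T}) (r c : T -> nat).

(** The transposition of x and y stabilizes both rows and columns; absorbing it
    into the row factor is free, into the column factor costs a sign. So
    fillings that repeat a box do not contribute to the expansion. *)
Lemma young_repeated A r c x y : x \in A -> y \in A -> x != y ->
  r x = r y -> c x = c y -> young A r c = 0.
Proof.
move=> Ax Ay nxy rxy cxy.
have Rt := tperm_level_stab Ax Ay rxy; have Ct := tperm_level_stab Ax Ay cxy.
have symt : sym_sum (level_stab A r) * gelt _ (tperm x y) = sym_sum (level_stab A r).
  by apply/ffunP=> g; rewrite galg_geltr !sym_sumE groupMr ?groupV.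
have altt : gelt _ (tperm x y) * alt_sum (level_stab A c) = - alt_sum (level_stab A c).
  apply/ffunP=> g; rewrite galg_geltl -[- _]scaleN1r galg_scaleE !alt_sumE.
  rewrite groupMl ?groupV // odd_permM odd_permV odd_tperm nxy mulrA signr_addb.
  by rewrite expr1.
have eqN : young A r c = - young A r c.
  by rewrite {1}/young -symt -mulrA altt mulrN.
have two_neq0 : 2%:R != 0 :> algC by rewrite pnatr_eq0.
by apply: (scalerI two_neq0); rewrite scaler0 scaler_nat mulr2n {1}eqN addNr.
Qed.

(** The two factors are inverted when passing to the inverse permutation, so
    the column factor now comes first. *)
Lemma young_invE A r c g : young A r c g^-1%g =
  \sum_(gamma in perm.Sym A) \sum_(sigma in perm.Sym A | (gamma * sigma)%g == g)
    (-1) ^+ gamma * ((gamma \in level_stab A c) && (sigma \in level_stab A r))%:R.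
Proof.
have inS f s : s \in level_stab A f -> s \in perm.Sym A.
  exact/subsetP/level_stab_sub.
rewrite (exchange_big_dep (mem (perm.Sym A))) /= => [|gamma sigma _ /andP[] //].
rewrite youngE (reindex_inj invg_inj) big_mkcond [RHS]big_mkcond /=.
apply: eq_bigr => sigma _; rewrite groupV invgK.
case: (boolP (sigma \in perm.Sym A)) => Ss; last first.
  by case: ifP => // /inS; rewrite (negPf Ss).
rewrite (eq_bigl (fun gamma =>
    (gamma == g * sigma^-1)%g && (gamma \in perm.Sym A))).
  rewrite big_mkcondr big_pred1_eq -[(sigma * g^-1)%g]invgK invMg invgK.
  rewrite groupV odd_permV.
  case: (boolP (sigma \in level_stab A r)) => [Rs|Rs]; last first.
    by rewrite andbF mulr0 !if_same.
  rewrite andbT; case: (boolP (_ \in level_stab A c)) => [/inS->|Cs] //.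
  by rewrite mulr0 if_same.
by move=> gamma; rewrite andbC /= -(inj_eq (mulIg sigma^-1%g)) mulgK.
Qed.

End YoungSum.

(** * Colorings as fillings *)

Lemma level_stab_porbit (T : finType) (A : {set T}) f (s : {perm T}) x y :
  s \in level_stab A f -> x \in A -> y \in porbit s x -> f y = f x.
Proof.
move=> fs Ax /porbitP[i ->].
by have /level_stabP[_ ->] := groupX i fs.
Qed.

Lemma porbit_sub (T : finType) (A : {set T}) (s : {perm T}) x :
  s \in perm.Sym A -> x \in A -> porbit s x \subset A.
Proof.
move=> As Ax; apply/subsetP=> y /porbitP[i ->].
by have := groupX i As; rewrite inE => /perm_closed->.
Qed.

Section CountColorings.

Variables (n l : nat) (lam : seq nat) (b : nat * nat) (r c : 'I_n.+1 -> nat).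
Hypothesis l_gt0 : (0 < l)%N.
Hypothesis lam_sorted : sorted geq lam.
Hypothesis tab : is_tableau [set: 'I_n.+1] lam r c.
Hypothesis rc0 : (r ord0, c ord0) = b.

Let A := first_points n.+1 l.

(** Boxes of lam are represented by the points that occupy them in the tableau,
    so a filling is a map from the first l points to all points; outside the
    first l points it is the identity, so that each such map is counted once. *)
Definition fillings : {set {ffun 'I_n.+1 -> 'I_n.+1}} :=
  [set f : {ffun 'I_n.+1 -> 'I_n.+1} |
    (f ord0 == ord0) && [forall x in ~: A, f x == x]].

Let A0 : ord0 \in A. Proof. by rewrite inE. Qed.

Let r_lt y : (r y < size lam)%N.
Proof.
have [_ /(_ y (in_setT _)) fr _] := tab; move: fr; apply: contraTT.
by rewrite -leqNgt /in_frame /= => le_r; rewrite nth_default.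
Qed.

Let c_lt y : (c y < head 0%N lam)%N.
Proof.
have [_ /(_ y (in_setT _)) fr _] := tab; rewrite -nth0.
apply: leq_trans fr _; rewrite /=.
have := sorted_leq_nth (fun x y z xy yz => leq_trans yz xy) leqnn 0%N lam_sorted.
by move/(_ 0%N (r y)); apply; rewrite ?inE ?r_lt // (leq_trans _ (r_lt y)).
Qed.

Variables gamma sigma : 'S_n.+1.
Hypothesis Agamma : gamma \in perm.Sym A.
Hypothesis Asigma : sigma \in perm.Sym A.

Let gammaA : perm_on A gamma. Proof. by move: Agamma; rewrite inE. Qed.
Let sigmaA : perm_on A sigma. Proof. by move: Asigma; rewrite inE. Qed.

Let first_cycle (g : 'S_n.+1) : cycleT l g :=
  Sub (porbit g ord0) (imset_f (porbit g) A0).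

Let cycle (g : 'S_n.+1) x : cycleT l g := insubd (first_cycle g) (porbit g x).

Let val_cycle g x : x \in A -> val (cycle g x) = porbit g x.
Proof. by move=> Ax; rewrite val_insubd (imset_f (porbit g) Ax). Qed.

Let cycle_ex g (C : cycleT l g) : exists2 x, x \in A & C = cycle g x.
Proof.
by have /imsetP[x Ax defC] := valP C; exists x => //; apply: val_inj; rewrite val_cycle.
Qed.

Let cycle_eq g (C : cycleT l g) z : g \in perm.Sym A -> z \in val C ->
  z \in A /\ C = cycle g z.
Proof.
have [x Ax ->] := cycle_ex C; rewrite val_cycle // => Ag xz.
have Az := subsetP (porbit_sub Ag Ax) z xz; split=> //.
by apply: val_inj; rewrite !val_cycle //; apply/esym/eqP; rewrite eq_porbit_mem.
Qed.

Let contains_firstE g (C : cycleT l g) : g \in perm.Sym A ->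
  contains_first (val C) -> C = cycle g ord0.
Proof.
move=> Ag /exists_inP[x Cx /eqP x0]; have -> : ord0 = x by apply: val_inj.
by have [] := cycle_eq Ag Cx.
Qed.

Let at_box (b' : nat * nat) : 'I_n.+1 := odflt ord0 [pick y | (r y, c y) == b'].

Let at_boxP b' : in_frame lam b' -> (r (at_box b'), c (at_box b')) = b'.
Proof.
have [_ _ surj] := tab; move=> /surj[y _ rcy]; rewrite /at_box.
by case: pickP => [z /eqP //|/(_ y)]; rewrite rcy eqxx.
Qed.

Let at_boxK y : at_box (r y, c y) = y.
Proof.
have [inj fr _] := tab.
by have [] := at_boxP (fr y (in_setT _)); apply: inj; rewrite inE.
Qed.

Let coloring := ({ffun cycleT l gamma -> 'I_(head 0%N lam)} *
                 {ffun cycleT l sigma -> 'I_(size lam)})%type.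

Let colors (h : coloring) x : nat * nat :=
  (nat_of_ord (h.2 (cycle sigma x)), nat_of_ord (h.1 (cycle gamma x))).

Let filling (h : coloring) : {ffun 'I_n.+1 -> 'I_n.+1} :=
  [ffun x => if x \in A then at_box (colors h x) else x].

Let rep (C : {set 'I_n.+1}) := odflt ord0 [pick x in C].

Let rep_cycle g x : x \in A -> rep (val (cycle g x)) \in porbit g x.
Proof.
move=> Ax; rewrite val_cycle // /rep.
by case: pickP => // /(_ x); rewrite porbit_id.
Qed.

(** A coloring places x in the box whose column is the color of the cycle of x
    under gamma and whose row is the color of its cycle under sigma; the last
    condition on colorings says that this box exists. *)
Lemma num_coloringsE : num_colorings l lam b gamma sigma =
  #|[set f in fillings | (gamma \in level_stab A (c \o f)) &&
                         (sigma \in level_stab A (r \o f))]|.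
Proof.
rewrite /num_colorings; set S := [set h : _ * _ | _].
have frameS h x : h \in S -> x \in A -> in_frame lam (colors h x).
  rewrite inE => /and3P[_ _ /forallP frh] Ax.
  have /forallP/(_ (cycle sigma x))/implyP := frh (cycle gamma x).
  apply; apply/set0Pn; exists x.
  by rewrite inE !val_cycle // !porbit_id.
have rc_filling h x : h \in S -> x \in A ->
    (r (filling h x), c (filling h x)) = colors h x.
  by move=> Sh Ax; rewrite ffunE Ax at_boxP // frameS.
have inj_filling : {in S &, injective filling}.
  move=> h h' Sh Sh' eq_h.
  have eq_colors x : x \in A -> colors h x = colors h' x.
    by move=> Ax; rewrite -!rc_filling // eq_h.
  case: h h' eq_colors {Sh Sh' eq_h} => [h1 h2] [h1' h2'] eq_colors.
  congr (_, _); apply/ffunP=> C; have [x Ax ->] := cycle_ex C; apply: val_inj.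
    by have [] := eq_colors x Ax.
  by have [] := eq_colors x Ax.
rewrite -(card_in_imset inj_filling); apply: eq_card => f.
apply/imsetP/idP=> [[h Sh ->]|].
  rewrite inE [_ \in fillings]inE -andbA; apply/and4P; split.
  - rewrite ffunE A0 -[ord0 in X in _ == X]at_boxK rc0; apply/eqP; congr at_box.
    move: Sh; rewrite inE => /and3P[/forallP h1 /forallP h2 _].
    have first g : contains_first (val (cycle g ord0)).
      by apply/exists_inP; exists ord0; rewrite ?val_cycle ?porbit_id.
    have /implyP/(_ (first _))/eqP e1 := h1 (cycle gamma ord0).
    have /implyP/(_ (first _))/eqP e2 := h2 (cycle sigma ord0).
    by rewrite /colors e1 e2; case: (b).
  - by apply/forall_inP=> x; rewrite inE => /negPf Ax; rewrite ffunE Ax.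
  - apply/level_stabP; split=> // x Ax.
    have Agx : gamma x \in A.
      by rewrite (perm_closed _ gammaA).
    have [_ /= ->] := rc_filling h (gamma x) Sh Agx.
    have [_ ->] := rc_filling h x Sh Ax.
    congr (nat_of_ord (h.1 _)); apply: val_inj; rewrite !val_cycle //.
    by rewrite (porbit_perm gamma 1).
  apply/level_stabP; split=> // x Ax.
  have Asx : sigma x \in A.
    by rewrite (perm_closed _ sigmaA).
  have [/= -> _] := rc_filling h (sigma x) Sh Asx.
  have [-> _] := rc_filling h x Sh Ax.
  congr (nat_of_ord (h.2 _)); apply: val_inj; rewrite !val_cycle //.
  by rewrite (porbit_perm sigma 1).
rewrite inE => /and3P[]; rewrite inE => /andP[/eqP f0 /forall_inP f_out] Cf Rf.
pose h : coloring :=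
  ([ffun C : cycleT l gamma => Ordinal (c_lt (f (rep (val C))))],
   [ffun C : cycleT l sigma => Ordinal (r_lt (f (rep (val C))))]).
have colors_h x : x \in A -> colors h x = (r (f x), c (f x)).
  move=> Ax; rewrite /colors !ffunE /=; congr (_, _).
    exact: (level_stab_porbit Rf Ax (rep_cycle _ Ax)).
  exact: (level_stab_porbit Cf Ax (rep_cycle _ Ax)).
exists h; last first.
  apply/ffunP=> x; rewrite ffunE; case: ifP => Ax.
    by rewrite colors_h // at_boxK.
  by apply/eqP/f_out; rewrite inE Ax.
have [colors0 colors0'] := colors_h _ A0; rewrite f0 in colors0 colors0'.
rewrite inE; apply/and3P; split.
- apply/forallP=> C; apply/implyP=> /(contains_firstE Agamma)->.
  by rewrite colors0' -rc0.
- apply/forallP=> C; apply/implyP=> /(contains_firstE Asigma)->.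
  by rewrite colors0 -rc0.
apply/forallP=> C1; apply/forallP=> C2; apply/implyP=> /set0Pn[z].
rewrite inE => /andP[/(cycle_eq Agamma)[Az ->] /(cycle_eq Asigma)[_ ->]].
rewrite -/(colors h z) colors_h //.
by have [_ fr _] := tab; apply: fr; rewrite inE.
Qed.

End CountColorings.

(** * Expanding over pairs of permutations *)

Lemma card_first_points n l : (l <= n)%N -> #|first_points n l| = l.
Proof.
move=> le_ln; rewrite -[RHS]card_ord -!sum1_card.
rewrite (big_ord_widen n (fun=> 1%N) le_ln); apply: eq_bigl => i.
by rewrite inE.
Qed.

Lemma tableau_comp_perm (T : finType) lam r c (w : {perm T}) :
  is_tableau [set: T] lam r c -> is_tableau [set: T] lam (r \o w) (c \o w).
Proof.
case=> inj_rc fr surj; split=> [x y _ _ rxy cxy|x _|b' /surj[y _ rcy]].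
- by apply: (@perm_inj _ w); apply: inj_rc; rewrite ?inE.
- by apply: fr; rewrite inE.
by exists (w^-1%g y); rewrite ?inE //= permKV.
Qed.

Section Expansion.

Variables (n l : nat) (lam : seq nat) (r c : 'I_n.+1 -> nat).
Hypothesis l_gt0 : (0 < l)%N.
Hypothesis le_ln : (l <= n.+1)%N.
Hypothesis tab : is_tableau [set: 'I_n.+1] lam r c.

Let A := first_points n.+1 l.
Let K := perm.Sym_group (nonfirst_points n.+1).

Variable theta : 'S_n.+1.
Hypothesis Atheta : theta \in perm.Sym A.

(** The symmetrizer of the filling f, with repeated boxes allowed. *)
Let local_young (f : 'I_n.+1 -> 'I_n.+1) : algC :=
  young A (r \o f) (c \o f) theta^-1%g.

(** A conjugate of a Young symmetrizer is that of a permuted tableau, and at an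
    element of the symmetric group of A only the filling of A matters. *)
Lemma conj_sum_young_sum : conj_sum K (young [set: 'I_n.+1] r c) theta =
  \sum_(k in K) local_young k.
Proof.
have inv_conj (g : 'S_n.+1) : exists2 k, k \in K & (g ^ k = g^-1)%g.
  have [k k0 gk] := perm_inv_conj ord0 g.
  by exists k; rewrite // Sym_nonfirstE k0.
rewrite -(star_centralizes inv_conj (@conj_sum_centralizes _ _ K _)) starE galg_sumE.
rewrite (reindex_inj invg_inj); apply: eq_big => [k|k _]; first by rewrite groupV.
rewrite invgK -(@young_conj _ _ _ _ (r \o k) (c \o k)) //.
by apply: (young_restrict (tableau_comp_perm k tab)); rewrite ?subsetT ?groupV.
Qed.

(** A term depends only on the restriction of k to the first l points. Each
    injective filling extends to (n + 1 - l)! permutations, and the others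
    contribute zero. *)
Lemma sum_local_young : \sum_(k in K) local_young k =
  ((n.+1 - l)`!)%:R * \sum_(f in fillings n l) local_young f.
Proof.
have A0 : ord0 \in A by rewrite inE.
have eq_local (f f' : 'I_n.+1 -> 'I_n.+1) :
    {in A, f =1 f'} -> local_young f = local_young f'.
  move=> eq_f; rewrite /local_young /young.
  by congr ((sym_sum _ * alt_sum _) _); apply: eq_level_stab => x Ax /=; rewrite eq_f.
rewrite (partition_big (cut_outside A) (mem (fillings n l))) => [|k]; last first.
  rewrite Sym_nonfirstE => k0; rewrite /= inE ffunE A0 k0 /=.
  by apply/forall_inP=> x; rewrite inE => /negPf Ax; rewrite ffunE Ax.
rewrite mulr_sumr; apply: eq_bigr => f.
rewrite /= inE => /andP[/eqP f0 /forall_inP f_out].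
rewrite (eq_bigr (fun=> local_young f)) => [|k /andP[_ /eqP<-]]; last first.
  by apply: eq_local => x Ax; rewrite ffunE Ax.
rewrite sumr_const.
have [f_inj|f_rep] := boolP [forall x in A, forall y in A, (f x == f y) ==> (x == y)].
  rewrite -[LHS]mulr_natl; congr (_ *+ _ * _).
  rewrite -[X in (X - l)%N]card_ord -{1}(card_first_points le_ln).
  rewrite -(card_cut_outside (f := f)); first last.
  - by move=> x /f_out/eqP.
  - move=> x y Ax Ay eq_f; move/forall_inP/(_ x Ax)/forall_inP/(_ y Ay): f_inj.
    by rewrite eq_f eqxx => /eqP.
  apply: eq_card => k; rewrite [RHS]inE unfold_in /= Sym_nonfirstE.
  rewrite andb_idl // => /eqP eq_k.
  by apply/eqP; rewrite -[RHS]f0 -eq_k ffunE A0.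
suff -> : local_young f = 0 by rewrite mul0rn mulr0.
case/forall_inPn: f_rep => x Ax /forall_inPn[y Ay].
rewrite negb_imply => /andP[/eqP fxy nxy].
by rewrite /local_young (young_repeated Ax Ay nxy) ?ffunE //= fxy.
Qed.

Lemma sum_local_young_colorings b : sorted geq lam -> (r ord0, c ord0) = b ->
  \sum_(f in fillings n l) local_young f =
    \sum_(gamma in perm.Sym A)
      \sum_(sigma in perm.Sym A | (gamma * sigma)%g == theta)
        (-1) ^+ gamma * (num_colorings l lam b gamma sigma)%:R.
Proof.
move=> lam_sorted rc0.
under eq_bigr do rewrite /local_young young_invE.
rewrite exchange_big; apply: eq_bigr => gamma Ag.
rewrite exchange_big; apply: eq_bigr => sigma /andP[As _].
rewrite -mulr_sumr (num_coloringsE l_gt0 lam_sorted tab rc0) //.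
rewrite -sum1_card natr_sum; congr (_ * _).
rewrite big_mkcond [RHS]big_mkcond; apply: eq_bigr => f _.
rewrite [in RHS]inE; case: (f \in fillings n l) => //=.
by case: (_ && _).
Qed.

End Expansion.

Theorem theorem4p2 (n l : nat) (hl2 : (2 <= l)%N) (hln : (l <= n)%N)
    (lam mu : seq nat) (hlam : is_part n lam) (hmu : is_part n.-1 mu)
    (b : nat * nat) (hb : removes_box lam mu b)
    (theta : 'S_n) (htheta : theta \in perm.Sym (first_points n l)) :
  gen_char lam mu theta =
    ((n.-1 ^_ l.-1)%N)%:R^-1 *
    \sum_(gamma in perm.Sym (first_points n l))
      \sum_(sigma in perm.Sym (first_points n l) | (gamma * sigma)%g == theta)
        (-1) ^+ gamma * (num_colorings l lam b gamma sigma)%:R.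
Proof.
have l_gt0 : (0 < l)%N by apply: ltnW.
case: n => [|n] in hln hlam hmu theta htheta *; first by case: l hl2 hln {l_gt0 htheta}.
have [r [c [tab rc0 ->]]] := gen_char_conj_sum hlam hmu hb.
have lam_sorted : sorted geq lam by case/and3P: hlam.
rewrite (conj_sum_young_sum tab htheta) (sum_local_young r c l_gt0 hln).
rewrite (sum_local_young_colorings l_gt0 tab theta lam_sorted rc0) mulrA.
congr (_ * _) => /=.
have le_l1 : (l.-1 <= n)%N by rewrite -ltnS prednK.
have -> : (n.+1 - l = n - l.-1)%N by rewrite -{1}(prednK l_gt0) subSS.
rewrite -(ffact_fact le_l1) natrM invfM mulfVK //.
by rewrite pnatr_eq0 -lt0n fact_gt0.
Qed.
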